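(* Consider the stochastic differential equation $dx_t=(\lambda x_t+g(x_t))\,dt+\gamma(x_t)\,dW_t$ on $\mathbb{R}$, with $\lambda\in\mathbb{R}$ and $g,\gamma$ satisfying the regularity conditions and assumptions (H1)-(H5) of the context, and let $\alpha\ge1$. Then for any initial condition $x_0\in\mathbb{R}$ with $x_0\neq0$, $$\mathbb{P}\big[\forall t\ge0,\ x_t\neq0\big]=1.$$
   Context: $W=(W_t)_{t\ge0}$ is a standard real Brownian motion on a complete probability space $(\Omega,\mathcal{F},\mathbb{P})$ with its natural filtration. For $x<0$ and $a>0$, $x^a$ denotes $-|x|^a$. Regularity conditions: $g:\mathbb{R}\to\mathbb{R}$ is locally Lipschitz continuous; and $\gamma:\mathbb{R}\to\mathbb{R}$ is such that for every $R>0$ there is a Borel function $\rho_R:(0,\infty)\to(0,\infty)$ with $\int_{0^+}dx/\rho_R(x)=\infty$ and $|\gamma(x)-\gamma(y)|^2\le\rho_R(|x-y|)$ for all $x\neq y$ in $[-R,R]$. Assumptions: (H1) $g(x)/x^{1+\kappa}\to\mu$ as $x\to0$, for some $\mu\in\mathbb{R}$ and $\kappa>0$. (H2) There are $A>0$, $\nu\in\mathbb{R}$, $\beta>0$ with $x\,g(x)\le-\nu|x|^{2+\beta}$ whenever $|x|\ge A$. (H3) $|\gamma(x)|/|x|^\alpha\to\sigma$ as $x\to0$, for some $\sigma\ge0$ and $\alpha>0$. (H4) For all sufficiently large $|x|$: if $\nu>0$, $\gamma^2(x)\le d|x|^{1+\beta}$ for some $d>0$; if $\nu<0$, $\gamma^2(x)\ge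 d|x|^{\delta}$ for some $d>0$ and $\delta>2+\beta$. (H5) $\gamma(x)$ vanishes at $x=0$ and only there. *)

(* Defs.v *)
From HB Require Import structures.
From mathcomp Require Import all_boot all_order all_algebra.
From mathcomp Require Import all_classical all_reals all_analysis.
From mathcomp Require Import measurable_realfun.

Set Implicit Arguments.
Unset Strict Implicit.
Unset Printing Implicit Defensive.

Import Order.TTheory GRing.Theory Num.Theory.
Import numFieldNormedType.Exports.

Local Open Scope classical_set_scope.
Local Open Scope ring_scope.

(* The signed power: [x ^ a] for [x >= 0] and [- |x| ^ a] for [x < 0]. *)
Definition signed_powR (R : realType) (x a : R) : R := Num.sg x * `|x| `^ a.

Definition locally_lipschitz (R : realType) (g : R -> R) : Prop :=
  forall a : R, exists2 U : set R, nbhs a U & [lipschitz g x | x in U].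

(* The Yamada-Watanabe type condition: no monotonicity or continuity of [rho]
   is required, only Borel measurability and the divergence of the integral of
   [1 / rho] at [0+]. *)
Definition yamada_watanabe (R : realType) (gamma : R -> R) : Prop :=
  forall r : R, 0 < r -> exists rho : R -> R,
    [/\ measurable_fun (`]0, +oo[ : set R) rho,
        forall u : R, 0 < u -> 0 < rho u,
        forall e : R, 0 < e ->
          (\int[lebesgue_measure]_(u in `]0%R, e]) ((rho u)^-1)%:E = +oo)%E
      & forall x y : R, x \in `[- r, r] -> y \in `[- r, r] -> x != y ->
          `|gamma x - gamma y| ^+ 2 <= rho `|x - y| ].

(* A process is a function [R -> T -> R] of time and of the outcome; only its
   values at times [t >= 0] are meaningful. *)

Definition measurable_wrt d (T : measurableType d) (R : realType)
    (G : set (set T)) (X : T -> R) : Prop :=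
  forall B : set R, measurable B -> G (X @^-1` B).

Definition adapted d (T : measurableType d) (R : realType)
    (F : R -> set (set T)) (X : R -> T -> R) : Prop :=
  forall t : R, 0 <= t -> measurable_wrt (F t) (X t).

Definition as_continuous d (T : measurableType d) (R : realType)
    (P : probability T R) (X : R -> T -> R) : Prop :=
  {ae P, forall w, {within `[0, +oo[, continuous (fun t : R => X t w)}}.

Definition natural_filtration d (T : measurableType d) (R : realType)
    (W : R -> T -> R) (t : R) : set (set T) :=
  <<s \bigcup_(s in `[0, t]) preimage_set_system setT (W s) measurable >>.

(* The natural filtration, completed by the null sets. *)
Definition augmented_filtration d (T : measurableType d) (R : realType)
    (P : probability T R) (W : R -> T -> R) (t : R) : set (set T) :=
  <<s natural_filtration W t `|` P.-negligible >>.

(* The second parameter of [normal_prob] is the standard deviation. *)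
Record brownian_motion d (T : measurableType d) (R : realType)
    (P : probability T R) (W : R -> T -> R) : Prop := BrownianMotion {
  bm_measurable : forall t : R, 0 <= t -> measurable_fun setT (W t) ;
  bm_start : {ae P, forall w, W 0 w = 0} ;
  bm_continuous : as_continuous P W ;
  bm_normal : forall (s t : R) (B : set R), 0 <= s -> s < t -> measurable B ->
    P ((fun w => W t w - W s w)%R @^-1` B) =
      normal_prob 0 (Num.sqrt (t - s)) B ;
  bm_independent : forall (s t : R) (A : set T) (B : set R), 0 <= s -> s < t ->
    natural_filtration W s A -> measurable B ->
    (P (A `&` (fun w => W t w - W s w)%R @^-1` B) =
      P A * P ((fun w => W t w - W s w)%R @^-1` B))%E }.

(* [Y n -> 0] in probability, for nonnegative extended random variables. *)
Definition cvg0_in_probability d (T : measurableType d) (R : realType)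
    (P : probability T R) (Y : nat -> T -> \bar R) : Prop :=
  (forall n, measurable_fun setT (Y n)) /\
  forall e : R, 0 < e -> P [set w | (e%:E <= Y n w)%E] @[n --> \oo] --> 0%E.

(* The simple process [\sum_(i < n) xi_i 1_(]t_i, t_(i+1)])], where [xi_i] is
   bounded and [F t_i]-measurable. *)
Record simple_process d (T : measurableType d) (R : realType)
    (F : R -> set (set T)) := SimpleProcess {
  sp_size : nat ;
  sp_time : nat -> R ;
  sp_coef : nat -> T -> R ;
  sp_time_ge0 : 0 <= sp_time 0%N ;
  sp_time_nd : {homo sp_time : m n / (m <= n)%N >-> m <= n} ;
  sp_coef_measurable : forall i, (i < sp_size)%N ->
    measurable_wrt (F (sp_time i)) (sp_coef i) ;
  sp_coef_bounded : forall i, (i < sp_size)%N ->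
    exists M : R, forall w, `|sp_coef i w| <= M }.

Definition sp_eval d (T : measurableType d) (R : realType)
    (F : R -> set (set T)) (H : simple_process F) (s : R) (w : T) : R :=
  \sum_(i < sp_size H)
    sp_coef H i w * \1_`]sp_time H i, sp_time H i.+1] s.

Definition sp_integral d (T : measurableType d) (R : realType)
    (F : R -> set (set T)) (W : R -> T -> R) (H : simple_process F)
    (t : R) (w : T) : R :=
  \sum_(i < sp_size H) sp_coef H i w *
    (W (Num.min (sp_time H i.+1) t) w - W (Num.min (sp_time H i) t) w).

(* [J] is (a continuous version of) the Ito integral [\int_0^t H dW]: on each
   [0, t], [H] is a limit, in probability for the distance of L^2([0, t]), of
   simple processes whose elementary integrals tend to [J t] in probability. *)
Definition ito_integral d (T : measurableType d) (R : realType)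
    (P : probability T R) (W H J : R -> T -> R) : Prop :=
  [/\ adapted (augmented_filtration P W) J,
      as_continuous P J
    & forall t : R, 0 <= t ->
      exists Hn : nat -> simple_process (augmented_filtration P W),
        cvg0_in_probability P (fun n w =>
          \int[lebesgue_measure]_(s in `[0%R, t])
            ((sp_eval (Hn n) s w - H s w) ^+ 2)%:E)%E /\
        cvg0_in_probability P (fun n w =>
          `|sp_integral W (Hn n) t w - J t w|%:E) ].

(* [X] is a solution on [0, +oo[ of [dX = b(X) dt + c(X) dW], [X 0 = x0]. *)
Record sde_solution d (T : measurableType d) (R : realType)
    (P : probability T R) (W : R -> T -> R) (b c : R -> R) (x0 : R)
    (X : R -> T -> R) : Prop := SdeSolution {
  sde_adapted : adapted (augmented_filtration P W) X ;
  sde_continuous : as_continuous P X ;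
  sde_integrable : {ae P, forall w, forall t : R, 0 <= t ->
    lebesgue_measure.-integrable `[0, t] (fun s => (b (X s w))%:E) /\
    lebesgue_measure.-integrable `[0, t] (fun s => (c (X s w) ^+ 2)%:E)} ;
  sde_equation : exists2 J : R -> T -> R,
    ito_integral P W (fun t w => c (X t w)) J &
    {ae P, forall w, forall t : R, 0 <= t ->
      X t w = x0 + Rintegral lebesgue_measure `[0, t] (fun s => b (X s w))
              + J t w} }.

(* Main.v *)
Require Import Defs.
From HB Require Import structures.
From mathcomp Require Import all_boot all_order all_algebra.
From mathcomp Require Import all_classical all_reals all_analysis.
From mathcomp Require Import measurable_realfun.
From mathcomp Require Import ring lra.
Set Implicit Arguments.
Unset Strict Implicit.
Unset Printing Implicit Defensive.
Import Order.TTheory GRing.Theory Num.Theory.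
Import numFieldNormedType.Exports.
Local Open Scope classical_set_scope.
Local Open Scope ring_scope.

(** Near [0] the drift and the diffusion coefficient are both at most
    [K * `|x|]: for the drift because [g] vanishes faster than linearly, for
    [gamma] because [1 <= alpha]. So, as long as the solution stays near [0],
    [ln `|X|] has bounded drift and bounded diffusion, and cannot reach minus
    infinity in finite time.

    The proof turns this heuristic into an estimate that needs neither the Ito
    formula nor stopped stochastic integrals. Its only probabilistic tool is the
    exponential inequality for simple integrands: for [M] the increment over
    [[s, t]] of the elementary integral of [H] and [V] the integral of [H ^+ 2]
    over [[s, t]], the expectation of [Z * expR (a * M - a ^+ 2 * V / 2)] is at
    most that of [Z], for all [a] and all nonnegative [Z] known at time [s]. It
    follows from the independence of the Brownian increments and the Gaussian
    moment generating function ([brownian_exponential_step]), first on an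
    interval where [H] is constant in time, then by concatenation
    ([step_integral_control]).

    On a grid [t 0 < t 1 < ...] of mesh [h], take [a i = 1 / X (t i)] up to the
    first grid time at which [`|X|] is at most [eps], and [a i = 0] afterwards.
    The averages [two_point] of the exponentials with coefficients [2 * a i] and
    [- 4 * a i] have a product of expectation at most [1]
    ([two_point_prod_le1]). Along a path that reaches [0], each factor before
    the stopping index is at least [X (t i) / X (t i.+1)] up to a factor
    [1 - O(h)]: the two exponents are chosen so that the quadratic variation is
    absorbed ([two_point_step]). The product telescopes, so it is at least of
    the order of [`|X (t 0)| / eps] ([two_point_prod_grid_ge]). By the Markov
    inequality, reaching [0] has probability of the order of [eps], hence zero
    ([negligible_hits_zero]).

    The elementary integrals used are those of one simple process that
    approximates the integrand [gamma (X t)]. That they are close to the Ito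
    integral at every grid time, although the integral is characterised at each
    time by a sequence of its own, is [sp_integral_consistent], again by the
    exponential inequality. It compares integrands along paths and so requires
    [gamma (X t)] to be measurable in time: the Yamada-Watanabe condition makes
    [gamma] continuous ([yamada_watanabe_continuous]). *)

(** * Continuity of the diffusion coefficient *)

Lemma measurable_inv (R : realType) : measurable_fun [set: R] (@GRing.inv R).
Proof.
rewrite (_ : @GRing.inv R = fun x => x * (x ^+ 2) `^ (-1)); last first.
  apply/funext => x; rewrite powR_inv1 ?sqr_ge0//.
  by have [->|x0] := eqVneq x 0; rewrite ?mul0r ?invr0// expr2 invfM mulVKf.
apply: measurable_funM => //=.
exact: (measurableT_comp (measurable_powR (-1)) (exprn_measurable 2)).
Qed.

Section steinhaus.
Context {R : realType}.
Local Notation mu := (@lebesgue_measure R).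

Lemma lebesgue_measure_preimage_shift (v : R) (A : set R) : measurable A ->
  mu ((fun x : R => x + v) @^-1` A) = mu A.
Proof.
move=> mA.
have mf : @measurable_fun _ _ (measurableTypeR R) (measurableTypeR R) setT
    (fun x => x + v).
  by apply: measurable_funD => //; exact: measurable_cst.
pose f : {mfun measurableTypeR R >-> measurableTypeR R} :=
  HB.pack ((fun x => x + v) : measurableTypeR R -> measurableTypeR R)
    (isMeasurableFun.Build _ _ _ _ _ mf).
apply/esym; rewrite -[RHS]/(pushforward mu f A).
apply: lebesgue_measure_unique => // _ [[a b]] _ <- /=.
rewrite /pushforward (_ : f @^-1` _ = `]a - v, b - v]%classic); last first.
  by apply/seteqP; split => x; rewrite /= !in_itv/= ltrBlDr lerBrDr.
rewrite !lebesgue_measure_itv/= !lte_fin ltrBlDr subrK; case: ifP => // _.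
by rewrite -!EFinB; congr (_%:E); ring.
Qed.

(** If [K] is compact of positive measure and [U] an open superset of measure
    less than twice that of [K], small translates of [K] stay inside [U] and so
    must overlap [K]. *)
Lemma steinhaus (D : set R) : measurable D -> (0 < mu D)%E -> (mu D < +oo)%E ->
  \forall v \near (0 : R), exists x y, [/\ D x, D y & x = y + v].
Proof.
move=> mD D0 Doo.
have Dfin : mu D \is a fin_num by rewrite ge0_fin_numE// ltW.
have eD : (0 < fine (mu D))%R by rewrite fine_gt0// D0.
have [K [cK KD DK]] := lebesgue_regularity_inner mD Doo eD.
have mK : measurable K.
  by apply: closed_measurable; apply: compact_closed => //; exact: Rhausdorff.
have K0 : (0 < mu K)%E.
  rewrite lt0e measure_ge0 andbT; apply/eqP => K0.
  move: DK; rewrite fineK//; apply/negP; rewrite -leNgt.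
  have -> : mu D = (mu (D `\` K) + mu (D `&` K))%E by exact: measureDI.
  by rewrite setIidr// K0 adde0.
have Koo : (mu K < +oo)%E.
  by apply: le_lt_trans Doo; rewrite le_measure ?inE.
have Kfin : mu K \is a fin_num by rewrite ge0_fin_numE.
have eK : (0 < fine (mu K))%R by rewrite fine_gt0// K0.
have [U [oU KU UK]] := lebesgue_regularity_outer mK Koo eK.
have mU : measurable U by exact: open_measurable.
move: UK; rewrite fineK// => UK.
have/compact_near_coveringP ncK := cK.
have : \forall v \near (0 : R), K `<=` (fun x => U (x + v)).
  apply: (ncK R (nbhs (0 : R)) (fun v x => U (x + v))) => x Kx.
  have : {for (x, 0), continuous (fun z : R * R => z.1 + z.2)}.
    by apply: add_continuous.
  move=> /(_ U); rewrite /= addr0; move=> cU.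
  by apply: cU; apply: open_nbhs_nbhs; split=> //; exact: KU.
apply: filterS => v KvU.
apply: contrapT => nxy.
pose Kv := (fun x : R => x + (- v)) @^-1` K.
have mKv : measurable Kv.
  rewrite -[Kv]setTI; apply: (_ : measurable_fun setT (fun x : R => x + - v)) => //.
  by apply: measurable_funD => //; exact: measurable_cst.
have muKv : mu Kv = mu K by rewrite /Kv lebesgue_measure_preimage_shift.
have KvUK : Kv `<=` U `\` K.
  move=> x Kvx; split; first by have := KvU _ Kvx; rewrite subrK.
  move=> Kx; apply: nxy; exists x, (x - v); split; [exact: KD|exact: KD|].
  by rewrite subrK.
suff : (mu K < mu K)%E by rewrite ltxx.
apply: le_lt_trans UK; rewrite -{1}muKv le_measure ?inE//.
exact: measurableD.
Qed.

(** The set where [rho] is at most [(e / 2) ^+ 2] has positive measure because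
    [1 / rho] is not integrable at [0], so the differences of its elements
    cover a neighbourhood of [0]; moving by such a difference changes [gamma]
    by at most [e]. *)
Lemma yamada_watanabe_continuous (gamma : R -> R) :
  yamada_watanabe gamma -> continuous gamma.
Proof.
move=> yw x; apply/cvgrPdist_le => e e0.
(* points at distance at most [1] from [x], shifted by an element of [`]0, 1]] *)
have r0 : 0 < `|x| + 2 by rewrite ltr_wpDl.
have [rho [mrho rho0 intrho ywr]] := yw _ r0.
pose D : set R := `]0, 1]%classic.
have mD : measurable D by exact: measurable_itv.
have D0oo : D `<=` `]0, +oo[%classic.
  by move=> u; rewrite /D /= !in_itv/= andbT => /andP[].
have mrhoD : measurable_fun D rho by apply: measurable_funS mrho.
pose U : set R := D `&` rho @^-1` `]-oo, (e / 2) ^+ 2]%classic.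
have mU : measurable U by apply: mrhoD => //; exact: measurable_itv.
have UD : U `<=` D by move=> u [].
have muD : mu D = 1%E.
  by rewrite /D lebesgue_measure_itv/= lte01 sube0.
have e20 : 0 < (e / 2) ^+ 2 by rewrite exprn_gt0// divr_gt0.
have U0 : (0 < mu U)%E.
  rewrite lt0e measure_ge0 andbT; apply/eqP => U0.
  have mI : measurable_fun D (fun u => ((rho u)^-1)%:E).
    apply/measurable_EFinP.
    exact: (measurableT_comp (@measurable_inv R)).
  have I0 u : D u -> (0 <= ((rho u)^-1)%:E)%E.
    move=> /D0oo/=; rewrite in_itv/= andbT => u0.
    by rewrite lee_fin invr_ge0 ltW// rho0.
  have := intrho _ (@ltr01 R); rewrite -/D.
  have -> : (\int[mu]_(u in D) ((rho u)^-1)%:E =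
      \int[mu]_(u in U) ((rho u)^-1)%:E + \int[mu]_(u in D `\` U) ((rho u)^-1)%:E)%E.
    rewrite -ge0_integral_setU ?setDUK//; first exact: measurableD.
    by apply/disj_setPS => u [Uu []].
  rewrite null_set_integral//; last exact: measurable_funS mI.
  rewrite add0e => Ioo.
  suff : (\int[mu]_(u in D `\` U) ((rho u)^-1)%:E <= (((e / 2) ^+ 2)^-1)%:E)%E.
    by rewrite Ioo leye_eq.
  apply: (@le_trans _ _ (\int[mu]_(u in D `\` U) (((e / 2) ^+ 2)^-1)%:E)%E).
    apply: ge0_le_integral => //=.
    - exact: measurableD.
    - by move=> u [Du _]; exact: I0.
    - by apply: measurable_funS mI => // u [].
    - move=> u [Du nUu]; rewrite lee_fin lef_pV2 ?posrE//; last first.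
        by apply: rho0; have := D0oo _ Du; rewrite /= in_itv/= andbT.
      rewrite leNgt; apply/negP => rhou; apply: nUu; split => //=.
      by rewrite in_itv/= ltW.
  rewrite integral_cst//; last exact: measurableD.
  rewrite -[leRHS]mule1 lee_pmul2l// ?lte_fin ?invr_gt0//.
  have <- : mu D = 1%E by [].
  by apply: le_measure; rewrite ?inE//; exact: measurableD.
have Uoo : (mu U < +oo)%E.
  by apply: (@le_lt_trans _ _ (mu D)); [rewrite le_measure ?inE|rewrite muD ltry].
have step u y : U u -> y \in `[x - 1, x + 1] -> y + u \in `[- (`|x| + 2), `|x| + 2] ->
    `|gamma y - gamma (y + u)| <= e / 2.
  move=> [Du /=]; rewrite in_itv/= => rhou yI yuI.
  have u0 : 0 < u by have := D0oo _ Du; rewrite /= in_itv/= andbT.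
  rewrite -(@ler_pXn2r _ 2) ?nnegrE//; last by rewrite divr_ge0 ?ltW.
  apply: le_trans rhou.
  have yyu : y - (y + u) = - u by ring.
  have := ywr y (y + u) _ yuI; rewrite yyu normrN (gtr0_norm u0).
  apply; last by rewrite -subr_eq0 yyu oppr_eq0 gt_eqF.
  move: yI; rewrite !in_itv/=; have := ler_norm x; have := ler_norm (- x).
  by rewrite normrN; lra.
have := steinhaus mU U0 Uoo; move=> sU.
have sx : \forall y \near x, exists u v, [/\ U u, U v & u = v + (y - x)].
  have : (y - x) @[y --> x] --> (0 : R).
    by rewrite -(subrr x); apply: cvgB; [exact: cvg_id|exact: cvg_cst].
  by move=> /(_ _ sU).
near=> y.
have yx : `|x - y| < 1.
  by near: y; apply: cvgr_dist_lt => //; exact: cvg_id.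
have [u [v [Uu Uv uv]]] : exists u v, [/\ U u, U v & u = v + (y - x)] by near: y.
have yv : y + v = x + u by rewrite uv; ring.
have := UD _ Uu; have := UD _ Uv; rewrite /D/= !in_itv/= => /andP[v0 v1] /andP[u0 u1].
have x1 := ler_norm x; have x2 := ler_norm (- x); rewrite normrN in x2.
have H1 : `|gamma x - gamma (x + u)| <= e / 2.
  by apply: step => //; rewrite in_itv/=; lra.
have H2 : `|gamma y - gamma (x + u)| <= e / 2.
  move: yx; rewrite ltr_norml => /andP[yx1 yx2].
  by rewrite -yv; apply: step; rewrite // in_itv/=; lra.
rewrite (_ : _ - _ = (gamma x - gamma (x + u)) - (gamma y - gamma (x + u))); last by ring.
by rewrite (le_trans (ler_normB _ _))// (splitr e) lerD.
Unshelve. all: by end_near. Qed.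

End steinhaus.

(** * Brownian increments and the augmented filtration *)

Section gaussian.
Context {R : realType}.
Local Notation mu := (@lebesgue_measure R).

Lemma ge0_integral_normal_prob (m s : R) (f : R -> \bar R) :
  measurable_fun setT f -> (forall x, 0 <= f x)%E ->
  (\int[normal_prob m s]_x f x = \int[mu]_x (f x * (normal_pdf m s x)%:E))%E.
Proof.
move=> mf f0.
have dom := normal_prob_dominates m s.
pose g := Radon_Nikodym_SigmaFinite.f (normal_prob m s) mu.
rewrite -(Radon_Nikodym_SigmaFinite.change_of_variables dom f0 measurableT mf).
have gi : mu.-integrable [set: R] g by exact: Radon_Nikodym_SigmaFinite.f_integrable.
have mg := measurable_int _ gi.
have mpdf : measurable_fun [set: R] (fun x => (normal_pdf m s x)%:E).
  by apply/measurable_EFinP; exact: measurable_normal_pdf.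
apply: ae_eq_integral => //; [exact: emeasurable_funM|exact: emeasurable_funM|].
apply: ae_eqe_mul2l; apply: integral_ae_eq => // E _ mE.
by rewrite -Radon_Nikodym_SigmaFinite.f_integral.
Qed.

(** Completing the square turns the density of [N(0, v)] into that of
    [N(a * v, v)]. *)
Lemma integral_normal_expR (a v : R) : 0 < v ->
  (\int[normal_prob 0 (Num.sqrt v)]_y (expR (a * y - a ^+ 2 * v / 2))%:E = 1)%E.
Proof.
move=> v0.
have sv0 : Num.sqrt v != 0 by rewrite gt_eqF// sqrtr_gt0.
rewrite ge0_integral_normal_prob; last 2 first.
- apply/measurable_EFinP; apply: measurableT_comp => //.
  exact: measurable_funB.
- by move=> x; rewrite lee_fin expR_ge0.
rewrite -[RHS](@integral_normal_pdf R (a * v) (Num.sqrt v)).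
apply: eq_integral => x _; rewrite -EFinM; congr (_%:E).
rewrite !normal_pdfE// mulrCA; congr (_ * _).
rewrite /normal_fun -expRD; congr expR.
rewrite sqr_sqrtr ?(ltW v0)// -mulr_natr; field.
by rewrite gt_eqF.
Qed.

End gaussian.

Section augmented.
Context {d : measure_display} {T : measurableType d} {R : realType}.
Context {P : probability T R}.
Context {W : R -> T -> R}.
Hypothesis Pc : measure_is_complete P.
Hypothesis BM : brownian_motion P W.

Local Notation N := (natural_filtration W).
Local Notation F := (augmented_filtration P W).

Lemma natural_filtration_measurable (s : R) (A : set T) : N s A -> measurable A.
Proof.
apply; split; first exact: sigma_algebra_measurable.
move=> B [u]; rewrite /= in_itv/= => /andP[u0 _] [C mC <-].
exact: (bm_measurable BM u0).
Qed.

Lemma augmented_filtration_measurable (s : R) (A : set T) : F s A -> measurable A.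
Proof.
apply; split; first exact: sigma_algebra_measurable.
by move=> B [|/Pc//]; exact: natural_filtration_measurable.
Qed.

Lemma augmented_filtration_mono (s t : R) : s <= t -> F s `<=` F t.
Proof.
move=> st; apply: sub_sigma_algebra2; apply: setSU.
apply: sub_sigma_algebra2; apply: bigcup_subset => u /=.
by rewrite !in_itv/= => /andP[-> us]; exact: le_trans st.
Qed.

(** The sets which agree with an event of the natural filtration up to a null
    set form a sigma-algebra. *)
Lemma augmented_filtration_approx (s : R) (A : set T) : F s A ->
  exists2 B, N s B & P.-negligible (A `+` B).
Proof.
have sN := smallest_sigma_algebra.
have [N0 NC NU] : sigma_algebra setT (N s) by exact: smallest_sigma_algebra.
apply: (_ : F s `<=` [set A | exists2 B, N s B & P.-negligible (A `+` B)]).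
apply: smallest_sub; last first.
  move=> B [NB|nB]; first by exists B => //; rewrite setYK; exact: negligible_set0.
  by exists set0 => //; rewrite setY0.
split.
- by exists set0 => //; rewrite setYK; exact: negligible_set0.
- move=> A' [B NB nB]; exists (setT `\` B); first exact: NC.
  apply: negligibleS nB => w; rewrite /setY/= /setD/=.
  by have [|] := pselect (A' w); have [|] := pselect (B w); tauto.
- move=> G HG.
  pose B i := sval (cid2 (HG i)).
  have NB i : N s (B i) by rewrite /B; case: cid2.
  have nB i : P.-negligible (G i `+` B i) by rewrite /B; case: cid2.
  exists (\bigcup_i B i); first exact: NU.
  apply: negligibleS (negligible_bigcup nB) => w [[[i _ Gi] nBw]|[[i _ Bi] nGw]].
    by exists i => //; left; split => // Biw; apply: nBw; exists i.
  by exists i => //; right; split => // Giw; apply: nGw; exists i.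
Qed.

Lemma measure_setY0 (A B : set T) : measurable A -> measurable B ->
  P.-negligible (A `+` B) -> P A = P B.
Proof.
move=> mA mB nAB.
have n1 : P (A `\` B) = 0%E.
  by apply: measure_negligible; [exact: measurableD|apply: negligibleS nAB => w; left].
have n2 : P (B `\` A) = 0%E.
  by apply: measure_negligible; [exact: measurableD|apply: negligibleS nAB => w; right].
have -> : P A = (P (A `\` B) + P (A `&` B))%E by exact: measureDI.
have -> : P B = (P (B `\` A) + P (B `&` A))%E by exact: measureDI.
by rewrite setIC n1 n2.
Qed.

Lemma brownian_increment_measurable (s t : R) : 0 <= s -> s < t ->
  measurable_fun setT (fun w => W t w - W s w).
Proof.
move=> s0 st; apply: measurable_funB.
  by apply: (bm_measurable BM); rewrite (le_trans s0)// ltW.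
exact: (bm_measurable BM).
Qed.

Lemma augmented_independent (s t : R) (A : set T) (B : set R) :
  0 <= s -> s < t -> F s A -> measurable B ->
  (P (A `&` (fun w => W t w - W s w)%R @^-1` B) =
   P A * normal_prob 0 (Num.sqrt (t - s)) B)%E.
Proof.
move=> s0 st FA mB.
have mD : measurable ((fun w => W t w - W s w)%R @^-1` B).
  rewrite -[X in measurable X]setTI.
  exact: (brownian_increment_measurable s0 st).
have mA := augmented_filtration_measurable FA.
have [A' NA' nA'] := augmented_filtration_approx FA.
have mA' := natural_filtration_measurable NA'.
rewrite (measure_setY0 mA mA' nA').
rewrite (@measure_setY0 (A `&` _) (A' `&` (fun w => W t w - W s w)%R @^-1` B)).
- by rewrite (bm_independent BM)// (bm_normal BM).
- exact: measurableI.
- exact: measurableI.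
- by apply: negligibleS nA' => w; rewrite /setY/=; tauto.
Qed.

End augmented.

(** * The exponential inequality for one increment *)

Section exponential_step.
Context {d : measure_display} {T : measurableType d} {R : realType}.
Context {P : probability T R}.
Context {W : R -> T -> R}.
Hypothesis Pc : measure_is_complete P.
Hypothesis BM : brownian_motion P W.

Local Notation F := (augmented_filtration P W).

(** A copy of [T] whose measurable sets are the events known at time [s], so that
    being known at time [s] is ordinary measurability. *)
Definition past (s : R) : measurableType _ :=
  g_sigma_algebraType (natural_filtration W s `|` P.-negligible).

Definition known (s : R) (f : T -> R) := measurable_fun (setT : set (past s)) f.

Lemma measurable_wrt_known (s : R) (f : T -> R) :
  measurable_wrt (F s) f -> known s f.
Proof. by move=> mf _ B mB; rewrite setTI; exact: mf. Qed.

Lemma known_mono (s t : R) (f : T -> R) : s <= t -> known s f -> known t f.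
Proof.
by move=> st kf mT B mB; apply: (augmented_filtration_mono st); exact: kf.
Qed.

Lemma known_measurable (s : R) (f : T -> R) : known s f -> measurable_fun setT f.
Proof.
by move=> kf mT B mB; apply: (augmented_filtration_measurable Pc BM (s := s)); exact: kf.
Qed.

Lemma brownian_known (s : R) : 0 <= s -> known s (W s).
Proof.
move=> s0 mT B mB; rewrite setTI.
apply: sub_gen_smallest; left; apply: sub_gen_smallest.
exists s; first by rewrite /= in_itv/= s0 lexx.
by exists B => //; rewrite setTI.
Qed.

Let past_id (s : R) : T -> past s := id.

Let measurable_past_id (s : R) : measurable_fun setT (past_id s).
Proof.
move=> _ A mA; rewrite setTI.
exact: (augmented_filtration_measurable Pc BM (s := s)).
Qed.

(** The past and the increment are independent, so their joint law is a product
    measure: the increment can be integrated first, with [a] and [Z] frozen. *)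
Lemma brownian_exponential_step (s t : R) (a Z : T -> R) :
  0 <= s -> s < t -> known s a -> known s Z -> (forall w, 0 <= Z w) ->
  (\int[P]_w (Z w * expR (a w * (W t w - W s w) - a w ^+ 2 * (t - s) / 2))%:E
   = \int[P]_w (Z w)%:E)%E.
Proof.
move=> s0 st ka kZ Z0.
pose N : probability (measurableTypeR R) R := normal_prob 0 (Num.sqrt (t - s)).
pose pr w : past s * measurableTypeR R := (@past_id s w, W t w - W s w).
have mpr : measurable_fun setT pr.
  apply/measurable_fun_pairP; split => /=.
    exact: measurable_past_id.
  exact: (brownian_increment_measurable BM s0 st).
pose f (z : past s * measurableTypeR R) :=
  (Z z.1 * expR (a z.1 * z.2 - a z.1 ^+ 2 * (t - s) / 2))%:E.
have mf : measurable_fun setT f.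
  apply/measurable_EFinP; apply: measurable_funM.
    by apply: measurableT_comp => //.
  apply: measurableT_comp => //; apply: measurable_funB.
    apply: measurable_funM => //.
    exact: (measurableT_comp ka).
  apply: measurable_funM => //; apply: measurable_funM => //.
  by apply: measurable_funX; exact: (measurableT_comp ka).
have f0 z : (0 <= f z)%E by rewrite lee_fin mulr_ge0// expR_ge0.
pose pid : {mfun T >-> past s} := HB.pack (@past_id s)
  (isMeasurableFun.Build _ _ _ _ (@past_id s) (@measurable_past_id s)).
pose P' : probability (past s) R := distribution P pid.
pose mpid : {mfun T >-> (past s * measurableTypeR R)%type} := HB.pack pr
  (isMeasurableFun.Build _ _ _ _ pr mpr).
transitivity (\int[distribution P mpid]_z f z)%E.
  by rewrite ge0_integral_distribution.
transitivity (\int[P' \x N]_z f z)%E.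
  apply: eq_measure_integral => A mA _; apply/esym.
  apply: product_measure_unique => // {mA}A B mA mB.
  exact: (augmented_independent Pc BM s0 st).
rewrite fubini_tonelli1//.
transitivity (\int[P']_w (Z w)%:E)%E.
  apply: eq_integral => w _; rewrite /fubini_F /f /=.
  under eq_integral do rewrite EFinM.
  rewrite ge0_integralZl//=; last 2 first.
  - apply/measurable_EFinP; apply: measurableT_comp => //.
    exact: measurable_funB.
  - by rewrite lee_fin.
  by rewrite integral_normal_expR ?mule1// subr_gt0.
rewrite ge0_integral_distribution//=.
exact/measurable_EFinP.
Qed.

End exponential_step.

(** * The exponential inequality for step integrands *)

Section exponential_control.
Context {d : measure_display} {T : measurableType d} {R : realType}.
Context {P : probability T R}.
Context {W : R -> T -> R}.
Hypothesis Pc : measure_is_complete P.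
Hypothesis BM : brownian_motion P W.

Local Notation mu := (@lebesgue_measure R).
Local Notation F := (augmented_filtration P W).
Local Notation known := (@known d T R P W).

(** [M] and [V] stand for the increments over [[s, t]] of a stochastic integral
    and of its quadratic variation. Allowing the coefficient [a] and the weight
    [Z] to be any functions known at time [s] is what makes the property
    compatible with concatenation of intervals. *)
Record exp_control (s t : R) (M V : T -> R) : Prop := ExpControl {
  exp_control_M : known t M ;
  exp_control_V : known t V ;
  exp_control_le : forall a Z : T -> R, known s a -> known s Z ->
    (forall w, 0 <= Z w) ->
    (\int[P]_w (Z w * expR (a w * M w - a w ^+ 2 * V w / 2))%:E
     <= \int[P]_w (Z w)%:E)%E }.

Lemma known_exp_control_weight (s t : R) (a Z M V : T -> R) : s <= t ->
  known s a -> known s Z -> known t M -> known t V ->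
  known t (fun w => Z w * expR (a w * M w - a w ^+ 2 * V w / 2)).
Proof.
move=> st /(known_mono st) ka /(known_mono st) kZ kM kV.
apply: measurable_funM => //; apply: measurableT_comp => //.
apply: measurable_funB; first exact: measurable_funM.
apply: measurable_funM => //; apply: measurable_funM => //.
exact: measurable_funX.
Qed.

Lemma exp_control_cell (s t : R) (xi : T -> R) : 0 <= s -> s < t ->
  known s xi ->
  exp_control s t (fun w => xi w * (W t w - W s w))
    (fun w => xi w ^+ 2 * (t - s)).
Proof.
move=> s0 st kxi; have st' := ltW st.
have kxit := known_mono st' kxi.
split.
- apply: measurable_funM => //; apply: measurable_funB.
    by apply: brownian_known; rewrite (le_trans s0).
  exact: known_mono st' (brownian_known s0).
- by apply: measurable_funM => //; exact: measurable_funX.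
- move=> a Z ka kZ Z0.
  have kaxi : known s (fun w => a w * xi w) by exact: measurable_funM.
  rewrite -(brownian_exponential_step Pc BM s0 st kaxi kZ Z0).
  rewrite le_eqVlt; apply/orP; left; apply/eqP.
  apply: eq_integral => w _; do 3 f_equal.
  by rewrite exprMn; ring.
Qed.

Lemma exp_control_cat (s u t : R) (M V M' V' : T -> R) : s <= u -> u <= t ->
  exp_control s u M V -> exp_control u t M' V' ->
  exp_control s t (fun w => M w + M' w) (fun w => V w + V' w).
Proof.
move=> su ut [kM kV le1] [kM' kV' le2].
have kMt := known_mono ut kM; have kVt := known_mono ut kV.
split; [exact: measurable_funD|exact: measurable_funD|].
move=> a Z ka kZ Z0; apply: le_trans (le1 a Z ka kZ Z0).
have kau := known_mono su ka.
have kZu := known_exp_control_weight su ka kZ kM kV.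
apply: le_trans (le2 _ _ kau kZu _); last by move=> w; rewrite mulr_ge0// expR_ge0.
rewrite le_eqVlt; apply/orP; left; apply/eqP.
apply: eq_integral => w _; rewrite -[in RHS]mulrA -expRD; do 3 f_equal.
by ring.
Qed.

(** The break points are not required to be sorted: only the absence of break
    points in an interval matters, which makes the notion stable under
    differences. *)
Definition step_integral (L I : R -> T -> R) (bps : seq R) : Prop :=
  forall s t, 0 <= s -> s < t -> (forall p, p \in bps -> ~~ (s < p < t)) ->
  [/\ known s (L t), forall u w, s < u <= t -> L u w = L t w &
      forall w, I t w - I s w = L t w * (W t w - W s w)].

Lemma step_integral_sub (L I L' I' : R -> T -> R) (bps bps' : seq R) :
  step_integral L I bps -> step_integral L' I' bps' ->
  step_integral (fun t w => L t w - L' t w) (fun t w => I t w - I' t w)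
    (bps ++ bps').
Proof.
move=> H H' s t s0 st nobp.
have [|kL cL eL] := H s t s0 st.
  by move=> p pb; apply: nobp; rewrite mem_cat pb.
have [|kL' cL' eL'] := H' s t s0 st.
  by move=> p pb; apply: nobp; rewrite mem_cat pb orbT.
split; first exact: measurable_funB.
- by move=> u w ut; rewrite cL// cL'.
- by move=> w; rewrite mulrBl -eL -eL'; ring.
Qed.

Lemma simple_process_time_ge0 (H : simple_process F) (i : nat) : 0 <= sp_time H i.
Proof. by rewrite (le_trans (sp_time_ge0 H))// (sp_time_nd H). Qed.

Lemma sp_integral0 (H : simple_process F) (w : T) : sp_integral W H 0 w = 0.
Proof.
rewrite /sp_integral big1// => i _.
by rewrite !min_r ?simple_process_time_ge0// subrr mulr0.
Qed.

Lemma step_integral_simple (H : simple_process F) :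
  step_integral (sp_eval H) (sp_integral W H)
    [seq sp_time H i | i <- iota 0 (sp_size H).+1].
Proof.
move=> s t s0 st nobp.
have nob i : (i <= sp_size H)%N -> sp_time H i <= s \/ t <= sp_time H i.
  move=> iH; have := nobp (sp_time H i).
  rewrite negb_and -!leNgt => /(_ _)/orP; apply.
  by apply: map_f; rewrite mem_iota.
have nd (i : nat) : sp_time H i <= sp_time H i.+1 by exact: (sp_time_nd H).
have ind1 (i : 'I_(sp_size H)) u : s < u <= t ->
    \1_`]sp_time H i, sp_time H i.+1] u =
    (if (sp_time H i <= s) && (t <= sp_time H i.+1) then 1 else 0) :> R.
  move=> /andP[su ut]; rewrite indicE; case: ifPn => [/andP[ias tb]|nab].
    by rewrite mem_set//= in_itv/= (le_lt_trans ias su) (le_trans ut).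
  rewrite memNset//= in_itv/= => /andP[au ub]; move/negP: nab; apply.
  have [->/=|ta] := nob i (ltnW (ltn_ord i)).
    have [bs|//] := nob i.+1 (ltn_ord i).
    by have := lt_le_trans su ub; rewrite ltNge bs.
  by have := lt_le_trans au ut; rewrite ltNge ta.
split.
- apply: measurable_sum => i.
  rewrite (_ : (fun w => _) = fun w => sp_coef H i w *
    (if (sp_time H i <= s) && (t <= sp_time H i.+1) then 1 else 0)); last first.
    by apply/funext => w; rewrite ind1// st lexx.
  case: ifPn => [/andP[ias _]|_].
    under eq_fun do rewrite mulr1.
    apply: (known_mono ias); apply: measurable_wrt_known.
    exact: (sp_coef_measurable (ltn_ord i)).
  under eq_fun do rewrite mulr0.
  exact: measurable_cst.
- move=> u w ut; apply: eq_bigr => i _.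
  by rewrite !ind1// st lexx.
- move=> w; rewrite /sp_integral /sp_eval -sumrB mulr_suml; apply: eq_bigr => i _.
  rewrite -mulrBr -mulrA; congr (_ * _).
  rewrite ind1 ?st ?lexx//; have st' := ltW st.
  have iab := nd i.
  have [ias|ta] := nob i (ltnW (ltn_ord i)).
    have [bs|tb] := nob i.+1 (ltn_ord i).
      rewrite (lt_geF (le_lt_trans bs st)) andbF mul0r.
      rewrite !min_l//; first by rewrite subrr.
      - exact: le_trans ias st'.
      - exact: le_trans bs st'.
    rewrite ias tb mul1r (min_r tb) (min_r (le_trans st' tb)).
    by rewrite !min_l//; [ring|exact: le_trans ias st'].
  rewrite (lt_geF (lt_le_trans st ta)) mul0r.
  have tb := le_trans ta iab.
  by rewrite !min_r//; first ring; rewrite (le_trans st').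
Qed.

Lemma itvoc_cat (s u t : R) : s <= u -> u <= t ->
  `]s, t]%classic = `]s, u]%classic `|` `]u, t]%classic.
Proof.
move=> su ut; apply/seteqP; split => x /=; rewrite !in_itv/=.
  by move=> /andP[sx xt]; have [xu|ux] := leP x u; [left; rewrite sx|right].
case=> /andP[h1 h2]; first by rewrite h1 (le_trans h2).
by rewrite h2 (le_lt_trans su).
Qed.

(** Induction on the list of break points: one that lies inside the interval
    cuts it into two, with fewer break points inside each. *)
Lemma step_integral_control (L I : R -> T -> R) (bps : seq R) :
  step_integral L I bps -> forall s t, 0 <= s -> s < t ->
  exists V : T -> R,
    exp_control s t (fun w => I t w - I s w) V /\
    forall w, measurable_fun `]s, t]%classic (L ^~ w) /\
      (\int[mu]_(u in `]s, t]) (L u w ^+ 2)%:E = (V w)%:E)%E.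
Proof.
move=> LI s t s0 st.
have [l] : exists l : seq R, forall p, p \in bps -> s < p < t -> p \in l.
  by exists bps.
elim: l s t s0 st => [|p l IH] s t s0 st sub.
  have [p pb|kL cL eL] := LI s t s0 st.
    by apply/negP => /(sub _ pb).
  exists (fun w => L t w ^+ 2 * (t - s)); split.
    rewrite (_ : (fun w => _) = fun w => L t w * (W t w - W s w)); last first.
      exact/funext.
    exact: exp_control_cell.
  move=> w; split.
    apply: (@eq_measurable_fun _ _ _ _ _ (cst (L t w))) => //.
    by move=> u; rewrite inE/= in_itv/= => /cL ->.
  under eq_integral => u.
    by rewrite inE/= in_itv/= => /cL ->; over.
  rewrite integral_cst//= lebesgue_measure_itv/= lte_fin st -EFinB.
  by rewrite -EFinM.
have [/andP[sp pt]|npst] := boolP (s < p < t).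
  have [|V [EV mV]] := IH s p s0 sp.
    move=> x xb /andP[sx xp].
    have := sub _ xb; rewrite sx (lt_trans xp pt) inE => /(_ isT).
    by rewrite lt_eqF.
  have [||V' [EV' mV']] := IH p t _ pt; first by rewrite (le_trans s0)// ltW.
    move=> x xb /andP[px xt].
    have := sub _ xb; rewrite xt (lt_trans sp px) inE => /(_ isT).
    by rewrite gt_eqF.
  exists (fun w => V w + V' w); split.
    rewrite (_ : (fun w => _) =
        fun w => (I p w - I s w) + (I t w - I p w)); last first.
      by apply/funext => w; ring.
    exact: exp_control_cat (ltW sp) (ltW pt) EV EV'.
  move=> w; have [m1 e1] := mV w; have [m2 e2] := mV' w.
  have m12 : measurable_fun (`]s, p]%classic `|` `]p, t]%classic) (L ^~ w).
    exact/measurable_funU.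
  rewrite (itvoc_cat (ltW sp) (ltW pt)); split => //.
  rewrite ge0_integral_setU//=.
  - by rewrite e1 e2 EFinD.
  - by apply/measurable_EFinP; exact: measurable_funX.
  - by move=> u _; rewrite lee_fin sqr_ge0.
  - apply/disj_setPS => u /=; rewrite !in_itv/= => -[/andP[_ up] /andP[pu _]].
    by move: up; rewrite leNgt pu.
apply: IH => // x xb xst; have := sub _ xb xst; rewrite inE => /predU1P[xp|//].
by move: npst; rewrite -xp xst.
Qed.

End exponential_control.

(** * Elementary integrals approximate the Ito integral at earlier times *)

Section consistency.
Context {d : measure_display} {T : measurableType d} {R : realType}.
Context {P : probability T R}.
Context {W : R -> T -> R}.
Hypothesis Pc : measure_is_complete P.
Hypothesis BM : brownian_motion P W.

Local Notation mu := (@lebesgue_measure R).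
Local Notation F := (augmented_filtration P W).
Local Notation known := (@known d T R P W).
Local Notation exp_control := (@exp_control d T R P W).

Lemma markov_le (f : T -> R) (c : R) : measurable_fun setT f ->
  (forall w, 0 <= f w) -> (\int[P]_w (f w)%:E <= 1)%E -> 0 < c ->
  measurable [set w | c <= f w] /\ (P [set w | (c <= f w)%R] <= (c^-1)%:E)%E.
Proof.
move=> mf f0 If c0.
have mA : measurable [set w | c <= f w].
  rewrite (_ : [set w | _] = setT `&` f @^-1` `[c, +oo[%classic).
    by apply: mf => //; exact: measurable_itv.
  by rewrite setTI; apply/seteqP; split => w; rewrite /= in_itv/= andbT.
split => //.
have mfE D : measurable_fun D (fun w => (f w)%:E).
  by apply/measurable_EFinP; exact: measurable_funTS.
rewrite -[leRHS]mul1e -lee_pdivrMr// ?invr_gt0// invrK muleC -integral_cst//.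
apply: le_trans If.
apply: (@le_trans _ _ (\int[P]_(w in [set w | (c <= f w)%R]) (f w)%:E)%E).
  apply: ge0_le_integral => //.
  by move=> w _; rewrite lee_fin ltW.
apply: ge0_subset_integral => //.
by move=> w _; rewrite lee_fin.
Qed.

(** Exponential Markov inequality with the coefficient [e / dl], which
    optimises the exponent; only the weaker rate [2 * dl / e ^+ 2] is kept. *)
Lemma exp_control_tail (s t : R) (M V : T -> R) (e dl : R) :
  exp_control s t M V -> 0 < e -> 0 < dl ->
  (P [set w | (e <= M w)%R /\ (V w <= dl)%R] <= (2 * dl / e ^+ 2)%:E)%E.
Proof.
move=> [kM kV le1] e0 dl0.
have mM := known_measurable Pc BM kM; have mV := known_measurable Pc BM kV.
pose a := e / dl.
pose f w := expR (a * M w - a ^+ 2 * V w / 2).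
have mf : measurable_fun setT f.
  apply: measurableT_comp => //; apply: measurable_funB; first exact: measurable_funM.
  by apply: measurable_funM => //; exact: measurable_funM.
have If : (\int[P]_w (f w)%:E <= 1)%E.
  have := le1 (cst a) (cst 1) (measurable_cst _) (measurable_cst _) (fun=> ler01).
  have -> : (\int[P]_w (cst 1 w)%:E = 1 :> \bar R)%E.
    rewrite (integral_cst P measurableT 1%E) mul1e; exact: probability_setT.
  by under eq_integral do rewrite mul1r.
have c0 : 0 < e ^+ 2 / (2 * dl) by rewrite divr_gt0 ?exprn_gt0// mulr_gt0.
have [mA PA] := markov_le mf (fun w => expR_ge0 _) If c0.
rewrite -invf_div; apply: le_trans PA.
have mB : measurable [set w | e <= M w /\ V w <= dl].
  rewrite (_ : [set w | _] = (setT `&` M @^-1` `[e, +oo[%classic) `&`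
                             (setT `&` V @^-1` `]-oo, dl]%classic)).
    by apply: measurableI; [apply: mM|apply: mV] => //; exact: measurable_itv.
  by rewrite !setTI; apply/seteqP; split => w; rewrite /= !in_itv/= andbT.
apply: le_measure; rewrite ?inE//.
move=> w /= [eM Vd]; rewrite /f.
have a0 : 0 < a by rewrite divr_gt0.
apply: le_trans (expR_ge1Dx _); rewrite -[leLHS]add0r lerD//.
have -> : e ^+ 2 / (2 * dl) = a * e - a ^+ 2 * dl / 2.
  by rewrite /a; field; rewrite gt_eqF.
rewrite lerB// ?ler_pM2l//.
by rewrite ler_pM2r ?invr_gt0// ler_pM2l// exprn_gt0.
Qed.

Lemma exp_controlN (s t : R) (M V : T -> R) :
  exp_control s t M V -> exp_control s t (fun w => - M w) V.
Proof.
move=> [kM kV le1]; split => //; first exact: measurableT_comp.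
move=> a Z ka kZ Z0.
have kNa : known s (fun w => - a w) by exact: measurableT_comp.
have := le1 _ Z kNa kZ Z0.
by under eq_integral do rewrite mulNr -mulrN sqrrN.
Qed.

Lemma measurable_sp_eval (H : simple_process F) (w : T) (D : set R) :
  measurable_fun D (sp_eval H ^~ w).
Proof.
by apply: measurable_sum => i; apply: measurable_funM.
Qed.

Lemma cvge0_near_lt (u : nat -> \bar R) (e : R) : u n @[n --> \oo] --> 0%E ->
  0 < e -> \forall n \near \oo, (u n < e%:E)%E.
Proof.
move=> u0 e0; apply: (u0 [set x | x < e%:E]%E); apply: (@open_nbhs_nbhs _ 0%E [set x | x < e%:E]%E).
by split; [exact: open_ereal_lt_ereal|rewrite /= lte_fin].
Qed.

Lemma probability_le_fin (A B : set T) (e : R) : measurable A -> measurable B ->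
  A `<=` B -> (P B <= e%:E)%E -> (P A <= e%:E)%E.
Proof. by move=> mA mB AB; apply: le_trans; apply: le_measure; rewrite ?inE. Qed.

Lemma probability_setU_le (A B : set T) (a b : R) :
  measurable A /\ (P A <= a%:E)%E -> measurable B /\ (P B <= b%:E)%E ->
  measurable (A `|` B) /\ (P (A `|` B) <= (a + b)%:E)%E.
Proof.
move=> [mA Pa] [mB Pb]; split; first exact: measurableU.
by rewrite (le_trans (measureU2 _ _ _))// EFinD leeD.
Qed.

Variables (Y J : R -> T -> R).
Hypothesis Yae : {ae P, forall w, forall D : R, 0 <= D ->
  measurable_fun `[0, D]%classic (Y ^~ w)}.
Hypothesis Jad : adapted F J.

Local Notation dist2 H t :=
  (fun w => \int[mu]_(s in `[0%R, t]) ((sp_eval H s w - Y s w) ^+ 2)%:E)%E.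

Lemma dist2_sub (H H' : simple_process F) (w : T) (s t : R) :
  0 <= s -> s <= t -> measurable_fun `[0, t]%classic (Y ^~ w) ->
  (\int[mu]_(u in `]0%R, s]) ((sp_eval H u w - sp_eval H' u w) ^+ 2)%:E <=
   2%:E * dist2 H t w + 2%:E * dist2 H' s w)%E.
Proof.
move=> s0 st mY.
have s0t : `[0, s]%classic `<=` `[0, t]%classic.
  by move=> u; rewrite /= !in_itv/= => /andP[-> us]; rewrite (le_trans us).
have ms0 : `]0, s]%classic `<=` `[0, s]%classic.
  by move=> u; rewrite /= !in_itv/= => /andP[/ltW -> ->].
have mH (K : simple_process F) (D : set R) : D `<=` `[0, t]%classic ->
    measurable_fun D (fun u => ((sp_eval K u w - Y u w) ^+ 2)%:E).
  move=> Dt; apply/measurable_EFinP/measurable_funX/measurable_funB.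
    exact: measurable_sp_eval.
  by apply: measurable_funS mY.
have H0 (K : simple_process F) u : (0 <= ((sp_eval K u w - Y u w) ^+ 2)%:E)%E.
  by rewrite lee_fin sqr_ge0.
have D0t : `]0, s]%classic `<=` `[0, t]%classic by exact: subset_trans ms0 s0t.
apply: (@le_trans _ _ (\int[mu]_(u in `]0%R, s])
   (2%:E * ((sp_eval H u w - Y u w) ^+ 2)%:E +
    2%:E * ((sp_eval H' u w - Y u w) ^+ 2)%:E))%E).
  apply: ge0_le_integral => //=.
  - by move=> u _; rewrite lee_fin sqr_ge0.
  - apply/measurable_EFinP/measurable_funX.
    by apply: measurable_funB; exact: measurable_sp_eval.
  - by apply: emeasurable_funD; apply: emeasurable_funM => //; exact: mH.
  - move=> u _; rewrite -!EFinM -EFinD lee_fin.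
    set a := sp_eval H u w; set b := sp_eval H' u w; set c := Y u w.
    by have := sqr_ge0 (a + b - 2 * c); nra.
rewrite ge0_integralD//=; last 4 first.
- by move=> u _; rewrite mule_ge0// ?H0// lee_fin.
- by apply: emeasurable_funM => //; exact: mH.
- by move=> u _; rewrite mule_ge0// ?H0// lee_fin.
- by apply: emeasurable_funM => //; exact: mH.
rewrite !ge0_integralZl//=; last 2 first.
- exact: mH.
- exact: mH.
by apply: leeD; apply: lee_wpmul2l => //; apply: ge0_subset_integral => //; exact: mH.
Qed.

(** The sequence approximating the integrand on [[0, t]] and the one on
    [[0, s]] have close integrals at time [s], since their difference is a step
    integrand with small quadratic variation. *)
Lemma sp_integral_consistent (s t : R) (H H' : nat -> simple_process F) :
  0 < s -> s <= t ->
  cvg0_in_probability P (fun n => dist2 (H n) t) ->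
  cvg0_in_probability P (fun n => dist2 (H' n) s) ->
  cvg0_in_probability P (fun n w => `|sp_integral W (H' n) s w - J s w|%:E) ->
  forall eta e : R, 0 < eta -> 0 < e -> \forall n \near \oo,
    measurable [set w | eta <= `|sp_integral W (H n) s w - J s w|] /\
    (P [set w | (eta <= `|sp_integral W (H n) s w - J s w|)%R] <= e%:E)%E.
Proof.
move=> s0 st [mD PD] [mD' PD'] [mI PI] eta e eta0 e0.
(* each of the two tails at level [eta / 2] is then at most [e / 8] *)
pose dl := e * eta ^+ 2 / 64.
have dl0 : 0 < dl by rewrite divr_gt0// mulr_gt0// exprn_gt0.
have dl40 : 0 < dl / 4 by rewrite divr_gt0.
have eta20 : 0 < eta / 2 by rewrite divr_gt0.
have e80 : 0 < e / 8 by rewrite divr_gt0.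
case: Yae => N0 [mN0 PN0 YN0].
near=> n.
have P1 : (P [set w | (dl / 4)%:E <= dist2 (H n) t w] < (e / 8)%:E)%E.
  by near: n; exact: cvge0_near_lt (PD _ dl40) e80.
have P2 : (P [set w | (dl / 4)%:E <= dist2 (H' n) s w] < (e / 8)%:E)%E.
  by near: n; exact: cvge0_near_lt (PD' _ dl40) e80.
have P3 : (P [set w | (eta / 2)%:E <= `|sp_integral W (H' n) s w - J s w|%:E] <
    (e / 8)%:E)%E.
  by near: n; exact: cvge0_near_lt (PI _ eta20) e80.
have [V [EV VE]] := step_integral_control Pc BM
  (step_integral_sub (@step_integral_simple d T R P W (H n)) (@step_integral_simple d T R P W (H' n)))
  (lexx 0) s0.
have [V1 [EV1 _]] := step_integral_control Pc BM (@step_integral_simple d T R P W (H n))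
  (lexx 0) s0.
have P4 := exp_control_tail EV eta20 dl0.
have P5 := exp_control_tail (exp_controlN EV) eta20 dl0.
set M := (fun w => _) in EV P4 P5.
have ME w : M w = sp_integral W (H n) s w - sp_integral W (H' n) s w.
  by rewrite /M !sp_integral0 subrr subr0.
have mM := known_measurable Pc BM (exp_control_M EV).
have mV := known_measurable Pc BM (exp_control_V EV).
have mJ : measurable_fun setT (J s).
  apply: (known_measurable Pc BM (s := s)); apply: measurable_wrt_known.
  by apply: Jad; exact: ltW.
have mHs : measurable_fun setT (sp_integral W (H n) s).
  rewrite (_ : sp_integral W (H n) s =
    fun w => sp_integral W (H n) s w - sp_integral W (H n) 0 w).
    exact: (known_measurable Pc BM (exp_control_M EV1)).
  by apply/funext => w; rewrite sp_integral0 subr0.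
have mle (f : T -> R) (c : R) : measurable_fun setT f -> measurable [set w | c <= f w].
  move=> mf; rewrite (_ : [set w | _] = setT `&` f @^-1` `[c, +oo[%classic).
    by apply: mf => //; exact: measurable_itv.
  by rewrite setTI; apply/seteqP; split => w; rewrite /= in_itv/= andbT.
have mge (f : T -> R) (c : R) : measurable_fun setT f -> measurable [set w | f w <= c].
  move=> mf; rewrite (_ : [set w | _] = setT `&` f @^-1` `]-oo, c]%classic).
    by apply: mf => //; exact: measurable_itv.
  by rewrite setTI; apply/seteqP; split => w; rewrite /= in_itv.
have mlee (f : T -> \bar R) (c : \bar R) : measurable_fun setT f ->
    measurable [set w | (c <= f w)%E].
  by move=> mf; rewrite -[X in measurable X]setTI; exact: emeasurable_fun_c_infty.
set A := [set w | eta <= _].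
have mA : measurable A.
  apply: mle; apply: measurableT_comp => //; exact: measurable_funB.
split => //.
set A1 := [set w | (dl / 4)%:E <= dist2 (H n) t w]%E in P1.
set A2 := [set w | (dl / 4)%:E <= dist2 (H' n) s w]%E in P2.
set A3 := [set w | _] in P3.
set A4 := [set w | _] in P4.
set A5 := [set w | _] in P5.
have mA1 : measurable A1 by exact: mlee.
have mA2 : measurable A2 by exact: mlee.
have mA3 : measurable A3 by exact: mlee.
have mA4 : measurable A4 by apply: measurableI; [exact: mle|exact: mge].
have mA5 : measurable A5.
  by apply: measurableI; [apply: mle; exact: measurableT_comp|exact: mge].
have sub : A `<=` N0 `|` (A1 `|` (A2 `|` (A3 `|` (A4 `|` A5)))).
  move=> w Aw.
  have [N0w|N0w] := pselect (N0 w); [by left|right].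
  have mYw : measurable_fun `[0, t]%classic (Y ^~ w).
    apply: contrapT => nY; apply: N0w; apply: YN0 => /= Yall; apply: nY.
    by apply: Yall; rewrite (le_trans (ltW s0)).
  have [A1w|A1w] := pselect (A1 w); [by left|right].
  have [A2w|A2w] := pselect (A2 w); [by left|right].
  have [A3w|A3w] := pselect (A3 w); [by left|right].
  have Vw : V w <= dl.
    rewrite -lee_fin -(VE w).2; apply: le_trans (dist2_sub _ _ (ltW s0) st mYw) _.
    move: A1w A2w => /negP; rewrite -ltNge => A1w /negP; rewrite -ltNge => A2w.
    rewrite [X in (_ <= X)%E](_ : dl%:E = 2%:E * (dl / 4)%:E + 2%:E * (dl / 4)%:E)%E.
      by apply: leeD; rewrite lee_pmul2l// ltW.
    by rewrite -!EFinM -EFinD; congr (_%:E); field.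
  move: Aw; rewrite /A/= => Aw.
  move: A3w => /negP; rewrite -ltNge lte_fin => A3w.
  have M1 : eta / 2 <= `|M w|.
    rewrite ME; move: Aw A3w; set x := sp_integral _ _ _ _; set y := sp_integral _ _ _ _.
    move=> xJ yJ; have := ler_normD (x - y) (y - J s w).
    by rewrite (_ : x - y + (y - J s w) = x - J s w); [lra|ring].
  by move: M1; rewrite ler_normr => /orP[M1|M1]; [left|right].
have tail : 2 * dl / (eta / 2) ^+ 2 = e / 8.
  by rewrite /dl; field; rewrite gt_eqF.
rewrite tail in P4 P5.
have [mU PU] : measurable (N0 `|` (A1 `|` (A2 `|` (A3 `|` (A4 `|` A5))))) /\
    (P (N0 `|` (A1 `|` (A2 `|` (A3 `|` (A4 `|` A5))))) <=
      (0 + (e / 8 + (e / 8 + (e / 8 + (e / 8 + e / 8)))))%:E)%E.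
  apply: probability_setU_le; first by rewrite PN0.
  do 3 (apply: probability_setU_le; first by split => //; exact: ltW).
  exact: probability_setU_le.
apply: (probability_le_fin mA mU sub); apply: le_trans PU _.
by rewrite lee_fin; lra.
Unshelve. all: by end_near. Qed.

End consistency.

(** * Products of two-point exponential averages *)

Section two_point_product.
Context {d : measure_display} {T : measurableType d} {R : realType}.
Context {P : probability T R}.
Context {W : R -> T -> R}.
Hypothesis Pc : measure_is_complete P.
Hypothesis BM : brownian_motion P W.

Local Notation known := (@known d T R P W).
Local Notation exp_control := (@exp_control d T R P W).

(** The average of the exponentials with coefficients [2 * a] and [- 4 * a]:
    to first order it equals [1 - a * M], and its second order term is large
    enough to dominate [1 / (1 + a * M)]. *)
Definition two_point (a M V : R) : R :=
  (expR (2 * a * M - (2 * a) ^+ 2 * V / 2) +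
   expR (- 4 * a * M - (- 4 * a) ^+ 2 * V / 2)) / 2.

Lemma two_point_ge0 (a M V : R) : 0 <= two_point a M V.
Proof. by rewrite divr_ge0// addr_ge0// expR_ge0. Qed.

Lemma two_point0 (M V : R) : two_point 0 M V = 1.
Proof.
rewrite /two_point !mulr0 expr0n/= !mul0r !subrr expR0.
by lra.
Qed.

Lemma exp_control_two_point (s t : R) (a Z M V : T -> R) : s <= t ->
  exp_control s t M V -> known s a -> known s Z -> (forall w, 0 <= Z w) ->
  known t (fun w => Z w * two_point (a w) (M w) (V w)) /\
  (\int[P]_w (Z w * two_point (a w) (M w) (V w))%:E <= \int[P]_w (Z w)%:E)%E.
Proof.
move=> st [kM kV le1] ka kZ Z0.
pose Z2 w := Z w / 2.
have kZ2 : known s Z2 by apply: measurable_funM.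
have Z20 w : 0 <= Z2 w by rewrite divr_ge0.
have kc (c : R) : known s (fun w => c * a w) by apply: measurable_funM.
have kf (c : R) := known_exp_control_weight st (kc c) kZ2 kM kV.
have E w : Z w * two_point (a w) (M w) (V w) =
    Z2 w * expR (2 * a w * M w - (2 * a w) ^+ 2 * V w / 2) +
    Z2 w * expR (- 4 * a w * M w - (- 4 * a w) ^+ 2 * V w / 2).
  by rewrite /two_point /Z2; field.
split; first by under eq_fun do rewrite E; apply: measurable_funD; exact: kf.
have mf (c : R) := known_measurable Pc BM (kf c).
under eq_integral do rewrite E EFinD.
rewrite ge0_integralD//=; last 4 first.
- by move=> w _; rewrite lee_fin mulr_ge0// expR_ge0.
- by apply/measurable_EFinP; exact: mf.
- by move=> w _; rewrite lee_fin mulr_ge0// expR_ge0.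
- by apply/measurable_EFinP; exact: mf.
apply: le_trans (leeD (le1 _ _ (kc 2) kZ2 Z20) (le1 _ _ (kc (- 4)) kZ2 Z20)) _.
have mZ2 := known_measurable Pc BM kZ2.
rewrite -ge0_integralD//=; last 4 first.
- by move=> w _; rewrite lee_fin.
- exact/measurable_EFinP.
- by move=> w _; rewrite lee_fin.
- exact/measurable_EFinP.
rewrite le_eqVlt; apply/orP; left; apply/eqP; apply: eq_integral => w _.
by rewrite -EFinD; congr (_%:E); rewrite /Z2; field.
Qed.

Definition two_point_prod (a M V : nat -> T -> R) (n : nat) (w : T) : R :=
  \prod_(i < n) two_point (a i w) (M i w) (V i w).

(** The partial products form a supermartingale: each factor has conditional
    expectation at most [1]. *)
Lemma two_point_prod_le1 (t : nat -> R) (a M V : nat -> T -> R) :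
  (forall i, t i <= t i.+1) ->
  (forall i, exp_control (t i) (t i.+1) (M i) (V i)) ->
  (forall i, known (t i) (a i)) -> forall n,
  known (t n) (two_point_prod a M V n) /\
  (\int[P]_w (two_point_prod a M V n w)%:E <= 1)%E.
Proof.
move=> tS EC ka; elim => [|n [kN IN]].
  split.
    rewrite (_ : two_point_prod _ _ _ _ = cst 1); first exact: measurable_cst.
    by apply/funext => w; rewrite /two_point_prod big_ord0.
  under eq_integral do rewrite /two_point_prod big_ord0.
  rewrite (integral_cst P measurableT 1%E) mul1e.
  by rewrite [leLHS](_ : _ = 1%E)//; exact: probability_setT.
have N0 w : 0 <= two_point_prod a M V n w.
  by apply: prodr_ge0 => i _; exact: two_point_ge0.
have [kS IS] := exp_control_two_point (tS n) (EC n) (ka n) kN N0.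
have E w : two_point_prod a M V n.+1 w =
    two_point_prod a M V n w * two_point (a n w) (M n w) (V n w).
  by rewrite /two_point_prod big_ord_recr.
split; first by rewrite (funext E).
by under eq_integral do rewrite E; exact: le_trans IS IN.
Qed.

End two_point_product.

Section path_induction.
Context {R : realType}.

(** With [rho := (y - x) / x], both [(1 + rho) ^+ 2] and [(1 - 2 * rho) ^+ 2]
    are below the corresponding exponentials, and their average is above
    [1 / (1 + rho) = x / y]. *)
Lemma two_point_step (x y M V k : R) : x != 0 -> `|y - x| <= `|x| / 4 ->
  0 <= V -> 4 * (`|y - x - M| / `|x|) + 8 * (V / x ^+ 2) <= k ->
  expR (- k) * `|x| <= two_point x^-1 M V * `|y|.
Proof.
move=> x0 yx V0 hk.
pose rho := (y - x) / x.
have nx0 : 0 < `|x| by rewrite normr_gt0.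
have rho4 : `|rho| <= 4^-1 by rewrite normf_div ler_pdivrMr// mulrC.
have /andP[rho1 rho2] : - 4^-1 <= rho <= 4^-1 by rewrite -ler_norml.
have yE : y = x * (1 + rho) by rewrite /rho; field.
have nyE : `|y| = `|x| * (1 + rho) by rewrite yE normrM (ger0_norm (_ : 0 <= 1 + rho))//; lra.
pose z := x^-1 * M; pose v := V / x ^+ 2.
have v0 : 0 <= v by rewrite divr_ge0// sqr_ge0.
have zrho : `|rho - z| = `|y - x - M| / `|x|.
  by rewrite -normf_div; congr (`| _ |); rewrite /rho /z; field.
have hk' : 4 * `|rho - z| + 8 * v <= k by rewrite zrho.
have /andP[rz1 rz2] : - `|rho - z| <= rho - z <= `|rho - z| by rewrite -ler_norml.
have sq (u : R) : -1 <= u -> (1 + u) ^+ 2 <= expR (2 * u).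
  move=> u1; rewrite (_ : 2 * u = u + u); last by ring.
  rewrite expRD -expr2; apply: lerXn2r; rewrite ?nnegrE ?expR_ge0//; first lra.
  exact: expR_ge1Dx.
have h1 : (1 + rho) ^+ 2 * expR (- k) <=
    expR (2 * x^-1 * M - (2 * x^-1) ^+ 2 * V / 2).
  apply: le_trans (_ : expR (2 * rho - k) <= _).
    by rewrite expRD ler_wpM2r ?expR_ge0// sq//; lra.
  rewrite ler_expR.
  have -> : 2 * x^-1 * M - (2 * x^-1) ^+ 2 * V / 2 = 2 * z - 2 * v.
    by rewrite /z /v; field.
  by lra.
have h2 : (1 - 2 * rho) ^+ 2 * expR (- k) <=
    expR (- 4 * x^-1 * M - (- 4 * x^-1) ^+ 2 * V / 2).
  apply: le_trans (_ : expR (2 * (- 2 * rho) - k) <= _).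
    rewrite expRD ler_wpM2r ?expR_ge0//.
    by have := sq (- 2 * rho); rewrite mulNr; apply; lra.
  rewrite ler_expR.
  have -> : - 4 * x^-1 * M - (- 4 * x^-1) ^+ 2 * V / 2 = - 4 * z - 8 * v.
    by rewrite /z /v; field.
  by lra.
have Q1 : 1 <= ((1 + rho) ^+ 2 + (1 - 2 * rho) ^+ 2) / 2 * (1 + rho) by nra.
rewrite nyE mulrCA mulrC ler_pM2l//.
apply: le_trans (_ : ((1 + rho) ^+ 2 * expR (- k) +
    (1 - 2 * rho) ^+ 2 * expR (- k)) / 2 * (1 + rho) <= _).
  rewrite -mulrDl [_ * expR _ / 2]mulrAC [_ * expR _ * _]mulrAC.
  by rewrite -[leLHS]mul1r ler_wpM2r// expR_ge0.
rewrite /two_point ler_wpM2r//; first lra.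
by rewrite ler_pM2r ?invr_gt0// lerD.
Qed.

(** The lower bounds of [two_point_step] telescope. *)
Lemma two_point_prod_ge (x M V : nat -> R) (k : R) (s : nat) :
  (forall i, (i < s)%N -> [/\ x i != 0, `|x i.+1 - x i| <= `|x i| / 4, 0 <= V i &
    4 * (`|x i.+1 - x i - M i| / `|x i|) + 8 * (V i / x i ^+ 2) <= k]) ->
  expR (- k *+ s) * `|x 0%N| <= \prod_(i < s) two_point (x i)^-1 (M i) (V i) * `|x s|.
Proof.
elim: s => [|s IH] H; first by rewrite mulr0n expR0 big_ord0.
have [x0 xx V0 hk] := H s (ltnSn s).
have := two_point_step x0 xx V0 hk; move=> step.
have IHs := IH (fun i si => H i (leqW si)).
rewrite mulrSr expRD mulrAC big_ord_recr/= -[leRHS]mulrA.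
set N := \prod_(i < s) _ in IHs *.
have N0 : 0 <= N by apply: prodr_ge0 => i _; exact: two_point_ge0.
apply: le_trans (ler_wpM2r (expR_ge0 (- k)) IHs) _.
by rewrite -mulrA [_ * expR _]mulrC ler_wpM2l.
Qed.

End path_induction.

(** * Continuous paths and their time integrals *)

Section path_analysis.
Context {R : realType}.
Local Notation mu := (@lebesgue_measure R).

Lemma path_continuousP (x : R -> R) :
  {within `[0, +oo[, continuous x} -> forall s e : R, 0 <= s -> 0 < e ->
  exists2 dl : R, 0 < dl &
    forall u, 0 <= u -> `|s - u| < dl -> `|x s - x u| <= e.
Proof.
move=> /subspace_continuousP cx s e s0 e0.
have s0' : `[0, +oo[%classic s by rewrite /= in_itv/= s0.
have /cvgrPdist_le/(_ e e0) := cx s s0'.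
rewrite /prop_near1/= /within/= => /nbhs_ballP[dl /= dl0 H].
by exists dl => // u u0 su; apply: H => //; rewrite in_itv/= u0.
Qed.

Lemma path_uniformly_continuous (x : R -> R) (a b e : R) :
  {within `[0, +oo[, continuous x} -> 0 <= a -> 0 < e ->
  exists2 dl : R, 0 < dl & forall u v, a <= u <= b -> a <= v <= b ->
    `|u - v| < dl -> `|x u - x v| <= e.
Proof.
move=> cx a0 e0.
have /compact_near_coveringP nc := @segment_compact R a b.
have : \forall dl \near (0 : R)^'+, `[a, b]%classic `<=`
    (fun u => a <= u <= b -> forall v, a <= v <= b -> `|u - v| < dl ->
       `|x u - x v| <= e).
  apply: (nc R (0^'+) (fun dl u => a <= u <= b -> forall v, a <= v <= b -> `|u - v| < dl ->
    `|x u - x v| <= e)) => s; rewrite /= in_itv/= => /andP[sa sb].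
  have e20 : 0 < e / 2 by rewrite divr_gt0.
  have [eta eta0 H] := path_continuousP cx (le_trans a0 sa) e20.
  have eta20 : 0 < eta / 2 by rewrite divr_gt0.
  near=> u dl => /andP[ua ub] v /andP[va vb] uv.
  have su : `|s - u| < eta / 2.
    by near: u; apply: cvgr_dist_lt => //; exact: cvg_id.
  have dle : dl < eta / 2 by near: dl; exact: nbhs_right_lt.
  have sv : `|s - v| < eta.
    have -> : eta = eta / 2 + eta / 2 by field.
    apply: le_lt_trans (ler_distD u s v) _; apply: ltrD => //.
    exact: lt_trans uv dle.
  have su' : `|s - u| < eta.
    by near: u; apply: cvgr_dist_lt => //; exact: cvg_id.
  have xsu := H u (le_trans a0 ua) su'.
  have xsv := H v (le_trans a0 va) sv.
  apply: le_trans (ler_distD (x s) (x u) (x v)) _.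
  by rewrite (splitr e) distrC lerD// distrC.
move=> [dl /= dl0 H]; exists (dl / 2); first by rewrite divr_gt0.
move=> u v uab vab uv; apply: (H (dl / 2)) => //=.
- rewrite sub0r normrN gtr0_norm ?divr_gt0//.
  by rewrite ltr_pdivrMr// ltr_pMr// ltr1n.
- by rewrite divr_gt0.
Unshelve. all: end_near.
Qed.

(** The first zero is the infimum of the closed set of zeros. *)
Lemma path_first_zero (x : R -> R) (t0 : R) :
  {within `[0, +oo[, continuous x} -> x 0 != 0 -> 0 <= t0 -> x t0 = 0 ->
  exists tau : R, [/\ 0 < tau, x tau = 0 & forall s, 0 <= s < tau -> x s != 0].
Proof.
move=> cx x0 t00 xt0.
pose Z := [set t : R | 0 <= t /\ x t = 0].
have lbZ : has_lbound Z by exists 0 => t [].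
have infZ : has_inf Z by split => //; exists t0.
have tau0 : 0 <= inf Z by apply: lb_le_inf => [|t []//]; exists t0.
have xtau : x (inf Z) = 0.
  apply/eqP; apply/negPn/negP => xn0.
  have e0 : 0 < `|x (inf Z)| / 2 by rewrite divr_gt0// normr_gt0.
  have [dl dl0 H] := path_continuousP cx tau0 e0.
  have [t [t1 xt] tdl] := inf_adherent dl0 infZ.
  have tge : inf Z <= t by exact: ge_inf.
  have := H t t1; rewrite xt subr0 ler0_norm ?subr_le0// => /(_ _).
  rewrite opprB ltrBlDl => /(_ tdl).
  by move: e0; lra.
exists (inf Z); split => //.
- rewrite lt_neqAle tau0 andbT; apply: contra x0 => /eqP tau00.
  by rewrite {1}tau00 xtau.
- move=> s /andP[s0 st]; apply/negP => /eqP xs.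
  by have := ge_inf lbZ (conj s0 xs : Z s); rewrite leNgt st.
Qed.

Lemma le_normr_Rintegral_itvB (f : R -> R) (C s t : R) : 0 <= s -> s <= t ->
  mu.-integrable `[0, t]%classic (EFin \o f) ->
  (forall u, s < u <= t -> `|f u| <= C) ->
  `|Rintegral mu `[0, t]%classic f - Rintegral mu `[0, s]%classic f| <= C * (t - s).
Proof.
move=> s0 st intf fC.
rewrite Rintegral_itvB ?bnd_simp//.
have sub : `]s, t]%classic `<=` `[0, t]%classic.
  by move=> u; rewrite /= !in_itv/= => /andP[su ->]; rewrite (ltW (le_lt_trans s0 su)).
have ints : mu.-integrable `]s, t]%classic (EFin \o f).
  by apply: integrableS intf => //; exact: measurable_itv.
apply: le_trans (le_normr_Rintegral _ ints) _ => //.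
have -> : C * (t - s) = Rintegral mu `]s, t]%classic (cst C).
  rewrite Rintegral_cst//= lebesgue_measure_itv/= lte_fin.
  case: ltP => [//|ts]; have -> : t = s by apply/eqP; rewrite eq_le ts st.
  by rewrite subrr.
apply: le_Rintegral => //.
- exact: integrable_norm.
- apply/integrableP; split; first exact/measurable_EFinP/measurable_cst.
  under eq_integral do rewrite /=.
  rewrite integral_cst//= lebesgue_measure_itv/= lte_fin.
  by case: ifP => _; rewrite ?mule0 ?ltry// -EFinB -EFinM ltry.
Qed.

Lemma step_quadratic_variation_le (h Y : R -> R) (C t0 s t eta V : R) :
  0 <= s -> s <= t -> t <= t0 ->
  measurable_fun setT h -> measurable_fun `[0, t0]%classic Y ->
  (\int[mu]_(u in `]s, t]) (h u ^+ 2)%:E = V%:E)%E ->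
  (\int[mu]_(u in `[0%R, t0]) ((h u - Y u) ^+ 2)%:E <= eta%:E)%E ->
  (forall u, s < u <= t -> `|Y u| <= C) ->
  V <= 2 * eta + 2 * C ^+ 2 * (t - s).
Proof.
move=> s0 st tt0 mh mY VE Deta YC.
have sub : `]s, t]%classic `<=` `[0, t0]%classic.
  move=> u; rewrite /= !in_itv/= => /andP[su ut].
  by rewrite (ltW (le_lt_trans s0 su)) (le_trans ut).
have mhs (D : set R) : measurable_fun D h by exact: measurable_funTS.
have mD : measurable_fun `[0, t0]%classic (fun u => ((h u - Y u) ^+ 2)%:E).
  exact/measurable_EFinP/measurable_funX/measurable_funB.
have mDs : measurable_fun `]s, t]%classic (fun u => ((h u - Y u) ^+ 2)%:E).
  exact: measurable_funS mD.
rewrite -lee_fin -VE.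
apply: (@le_trans _ _ (\int[mu]_(u in `]s, t])
   (2%:E * ((h u - Y u) ^+ 2)%:E + (2 * C ^+ 2)%:E))%E).
  apply: ge0_le_integral => //=.
  - by move=> u _; rewrite lee_fin sqr_ge0.
  - by apply/measurable_EFinP/measurable_funX; exact: mhs.
  - by apply: emeasurable_funD => //; exact: emeasurable_funM.
  - move=> u; rewrite in_itv/= => /YC YuC; rewrite -EFinM -EFinD lee_fin.
    have : Y u ^+ 2 <= C ^+ 2.
      by rewrite -(@real_normK _ (Y u)) ?num_real// lerXn2r ?nnegrE// (le_trans _ YuC).
    by have := sqr_ge0 (h u - 2 * Y u); nra.
rewrite ge0_integralD//=; last 3 first.
- by move=> u _; rewrite mule_ge0// lee_fin sqr_ge0.
- exact: emeasurable_funM.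
- by move=> u _; rewrite lee_fin mulr_ge0// sqr_ge0.
rewrite [leRHS]EFinD; apply: leeD.
  rewrite ge0_integralZl//=; last by move=> u _; rewrite lee_fin sqr_ge0.
  rewrite EFinM lee_wpmul2l//; apply: le_trans Deta.
  by apply: ge0_subset_integral => // u _; rewrite lee_fin sqr_ge0.
rewrite integral_cst//= lebesgue_measure_itv/= lte_fin.
case: ltP => [_|ts]; first by rewrite -EFinB -EFinM.
have -> : t = s by apply/eqP; rewrite eq_le ts st.
by rewrite subrr mulr0 mule0.
Qed.

End path_analysis.

(** * The lower bound along a path that reaches zero *)

Section grid_bound.
Context {R : realType}.
Local Notation mu := (@lebesgue_measure R).

Definition grid (q l : R) (n i : nat) : R := q + i%:R * (l / n.+1%:R).

Lemma gridS (q l : R) (n i : nat) : grid q l n i.+1 = grid q l n i + l / n.+1%:R.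
Proof. by rewrite /grid -natr1; ring. Qed.

Lemma grid0 (q l : R) (n : nat) : grid q l n 0 = q.
Proof. by rewrite /grid mul0r addr0. Qed.

Lemma grid_last (q l : R) (n : nat) : grid q l n n.+1 = q + l.
Proof. by rewrite /grid mulrC divfK// pnatr_eq0. Qed.

Lemma grid_le (q l : R) (n i k : nat) : 0 <= l -> (i <= k)%N ->
  grid q l n i <= grid q l n k.
Proof.
move=> l0 ik; rewrite lerD2l ler_wpM2r ?ler_nat//.
by rewrite divr_ge0.
Qed.

(** The coefficient [1 / x (t i)], switched off from the first index at which
    [x] is within [eps] of [0]. *)
Definition stopped_inv (x : R -> R) (t : nat -> R) (eps : R) (i : nat) : R :=
  (x (t i))^-1 * \prod_(k < i.+1) (eps < `|x (t k)|)%R%:R.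

Lemma stopped_inv_before (x : R -> R) (t : nat -> R) (eps : R) (s i : nat) :
  (forall k, (k < s)%N -> eps < `|x (t k)|) -> (i < s)%N ->
  stopped_inv x t eps i = (x (t i))^-1.
Proof.
move=> H si; rewrite /stopped_inv big1 ?mulr1// => k _.
by rewrite H// (leq_trans _ si).
Qed.

Lemma stopped_inv_after (x : R -> R) (t : nat -> R) (eps : R) (s i : nat) :
  `|x (t s)| <= eps -> (s <= i)%N -> stopped_inv x t eps i = 0.
Proof.
move=> xs si; rewrite /stopped_inv.
have si' : (s < i.+1)%N by [].
by rewrite (bigD1 (Ordinal si'))//= ltNge xs mul0r mulr0.
Qed.

(** On a cell before the stopping index, [x] varies by at most a quarter of its
    value at the left end, so the drift and the quadratic variation relative to
    that value are of the order of the mesh. *)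
Lemma two_point_prod_grid_ge (b c x j I : R -> R) (V : nat -> R)
    (x0 r K q l eps dl tau : R) (n : nat) (t := grid q l n)
    (eta := eps ^+ 2 / n.+1%:R) :
  0 < eps -> eps <= 1 -> 0 <= K -> 0 <= q -> 0 < l ->
  (forall y, y != 0 -> `|y| <= r -> `|b y| <= K * `|y| /\ `|c y| <= K * `|y|) ->
  (forall u, 0 <= u -> x u = x0 + Rintegral mu `[0, u] (fun s => b (x s)) + j u) ->
  (forall u, 0 <= u -> mu.-integrable `[0, u] (fun s => (b (x s))%:E)) ->
  (forall u v, q <= u <= q + l -> q <= v <= q + l -> `|u - v| <= l / n.+1%:R ->
     `|x u - x v| <= eps / 4) ->
  (forall u, q <= u <= tau -> `|x u| <= r) ->
  q < tau <= q + l -> x tau = 0 -> dl <= `|x q| ->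
  (forall i, (i <= n.+1)%N -> `|I (t i) - j (t i)| <= eta) ->
  (forall i, 0 <= V i) ->
  (forall i C, (i <= n)%N -> (forall u, t i < u <= t i.+1 -> `|c (x u)| <= C) ->
     V i <= 2 * eta + 2 * C ^+ 2 * (t i.+1 - t i)) ->
  expR (- (8 * K * l + 64 * K ^+ 2 * l + 24)) * dl / eps <=
    \prod_(i < n.+1)
       two_point (stopped_inv x t eps i) (I (t i.+1) - I (t i)) (V i).
Proof.
move=> eps0 eps1 K0 q0 l0 loc xE xint osc small /andP[qtau taul] xtau dlx
  close V0 VC.
pose h := l / n.+1%:R.
have n0 : 0 < n.+1%:R :> R by rewrite ltr0n.
have h0 : 0 < h by rewrite divr_gt0.
have nh : n.+1%:R * h = l by rewrite /h mulrC divfK// gt_eqF.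
have eta0 : 0 < eta by rewrite divr_gt0// exprn_gt0.
have tS i : t i.+1 = t i + h by rewrite /t gridS.
have tq i : q <= t i by rewrite -(grid0 q l n); apply: grid_le => //; exact: ltW.
have tql i : (i <= n.+1)%N -> t i <= q + l.
  by move=> ni; rewrite -(grid_last q l n); apply: grid_le => //; exact: ltW.
have t_ge0 i : 0 <= t i by exact: le_trans (tq i).
(* the grid point just before tau is already close to zero *)
pose m := Num.truncn ((tau - q) / h).
have [tm tm1] : t m <= tau /\ tau <= t m + h.
  have : 0 <= (tau - q) / h by rewrite divr_ge0 ?ltW// subr_gt0.
  move=> /truncn_itv/andP[]; rewrite -/m ler_pdivlMr// ltr_pdivrMr// -natr1 => m1 m2.
  rewrite /t /grid -/h; split; first by lra.
  by move: m2; rewrite mulrDl mul1r; lra.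
have mn : (m <= n.+1)%N.
  rewrite -(ler_nat R) -(ler_pM2r h0) nh.
  by move: tm; rewrite /t /grid -/h; lra.
have xm : `|x (t m)| <= eps.
  have := osc (t m) tau; rewrite xtau subr0 tq tql// (ltW qtau) taul.
  move=> /(_ isT isT) H; apply: le_trans (H _) _; last by lra.
  by rewrite ler0_norm ?subr_le0// opprB lerBlDl.
pose good i := `|x (t i)| <= eps.
have exg : exists i, good i by exists m.
case: (ex_minnP exg) => s gs smin.
have sm : (s <= m)%N by exact: smin.
have sn : (s <= n.+1)%N by exact: leq_trans mn.
have before k : (k < s)%N -> eps < `|x (t k)|.
  by move=> ks; rewrite ltNge; apply/negP => /smin; rewrite leqNgt ks.
(* per cell, the drift contributes [8 * K * h], the quadratic variation
   [64 * K ^+ 2 * h], and the approximation errors at most [24 / n.+1] *)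
pose k0 := (8 * K * l + 64 * K ^+ 2 * l + 24) / n.+1%:R.
have C0 : 0 <= 8 * K * l + 64 * K ^+ 2 * l + 24.
  by rewrite !addr_ge0// !mulr_ge0// ?sqr_ge0// ltW.
have k00 : 0 <= k0 by rewrite divr_ge0.
have cell i : (i < s)%N -> [/\ x (t i) != 0, `|x (t i.+1) - x (t i)| <= `|x (t i)| / 4,
    0 <= V i & 4 * (`|x (t i.+1) - x (t i) - (I (t i.+1) - I (t i))| / `|x (t i)|) +
      8 * (V i / x (t i) ^+ 2) <= k0].
  move=> si; have xi := before i si.
  have xi0 : 0 < `|x (t i)| by exact: lt_trans xi.
  have xin0 : x (t i) != 0 by rewrite -normr_gt0.
  have iS : (i < n.+1)%N by exact: leq_trans sn.
  have tSm : t i.+1 <= tau.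
    by apply: le_trans tm; apply: grid_le (ltW l0) _; exact: leq_trans sm.
  have oscu u : t i <= u <= t i.+1 -> `|x u - x (t i)| <= eps / 4.
    move=> /andP[u1 u2]; apply: osc.
    - by rewrite (le_trans (tq i))// (le_trans u2)// tql.
    - by rewrite tq tql// ltnW.
    - by rewrite ger0_norm ?subr_ge0// -/h; move: u2; rewrite tS; lra.
  have xu u : t i < u <= t i.+1 -> [/\ x u != 0, `|x u| <= r & `|x u| <= 2 * `|x (t i)|].
    move=> /andP[u1 u2].
    have := oscu u; rewrite (ltW u1) u2 => /(_ isT) o.
    have d1 := ler_normD (x u - x (t i)) (x (t i)); rewrite subrK in d1.
    have d2 := ler_normB (x u) (x u - x (t i)).
    rewrite opprB addrC subrK in d2.
    split; last by lra.
    - by rewrite -normr_gt0; lra.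
    - by apply: small; rewrite (le_trans (tq i) (ltW u1)) (le_trans u2).
  have bu u : t i < u <= t i.+1 -> `|b (x u)| <= 2 * K * `|x (t i)|.
    move=> /xu[u0 ur u2]; have [bK _] := loc _ u0 ur.
    by apply: le_trans bK _; rewrite [2 * K]mulrC -mulrA ler_wpM2l.
  have cu u : t i < u <= t i.+1 -> `|c (x u)| <= 2 * K * `|x (t i)|.
    move=> /xu[u0 ur u2]; have [_ cK] := loc _ u0 ur.
    by apply: le_trans cK _; rewrite [2 * K]mulrC -mulrA ler_wpM2l.
  split => //.
    apply: le_trans (oscu (t i.+1) _) _; last by lra.
    by rewrite lexx andbT tS; lra.
  have tiS : t i <= t i.+1 by rewrite tS; lra.
  have drift := le_normr_Rintegral_itvB (t_ge0 i) tiS (xint _ (t_ge0 i.+1)) bu.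
  have cl1 := close i.+1 iS; have cl2 := close i (ltnW iS).
  have Vi := VC i _ iS cu.
  have tSi : t i.+1 - t i = h by rewrite tS; ring.
  rewrite tSi in drift Vi.
  have num : `|x (t i.+1) - x (t i) - (I (t i.+1) - I (t i))| <=
      2 * K * `|x (t i)| * h + 2 * eta.
    move: drift cl1 cl2.
    set A := Rintegral _ _ _; set B := Rintegral _ _ _.
    have -> : x (t i.+1) - x (t i) = A - B + (j (t i.+1) - j (t i)).
      by rewrite (xE _ (t_ge0 i.+1)) (xE _ (t_ge0 i)) -/A -/B; ring.
    set a1 := I (t i.+1); set a2 := I (t i); set j1 := j (t i.+1); set j2 := j (t i).
    move=> drift cl1 cl2.
    rewrite (_ : _ - _ = (A - B) - (a1 - j1) + (a2 - j2)); last by ring.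
    apply: le_trans (ler_normD _ _) _.
    by have := ler_normB (A - B) (a1 - j1); lra.
  have t1 : `|x (t i.+1) - x (t i) - (I (t i.+1) - I (t i))| / `|x (t i)| <=
      2 * K * h + 2 * (eps / n.+1%:R).
    rewrite ler_pdivrMr//; apply: le_trans num _.
    have e0 : 0 <= eps / n.+1%:R by rewrite divr_ge0 ?ltW.
    have etaE : eta = eps / n.+1%:R * eps by rewrite /eta expr2 mulrAC.
    rewrite (_ : (2 * K * h + _) * _ = 2 * K * `|x (t i)| * h +
      2 * (eps / n.+1%:R * `|x (t i)|)); last by ring.
    by rewrite lerD2l ler_pM2l// etaE ler_wpM2l// ltW.
  have t2 : V i / x (t i) ^+ 2 <= 8 * K ^+ 2 * h + 2 / n.+1%:R.
    have x20 : 0 < x (t i) ^+ 2 by rewrite exprn_even_gt0.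
    rewrite ler_pdivrMr//; apply: le_trans Vi _.
    have n1 : 0 <= n.+1%:R^-1 :> R by rewrite invr_ge0 ltW.
    have X2 : `|x (t i)| ^+ 2 = x (t i) ^+ 2 by rewrite real_normK ?num_real.
    have e2 : eps ^+ 2 <= x (t i) ^+ 2.
      by rewrite -X2 lerXn2r ?nnegrE ?(ltW eps0) ?(ltW xi).
    rewrite (_ : (8 * K ^+ 2 * h + _) * _ = 2 * (x (t i) ^+ 2 / n.+1%:R) +
      2 * (2 * K * `|x (t i)|) ^+ 2 * h); last by rewrite exprMn X2; ring.
    by rewrite lerD2r ler_pM2l// /eta ler_wpM2r.
  have t3 : eps / n.+1%:R <= 1 / n.+1%:R by rewrite ler_wpM2r ?invr_ge0 ?(ltW n0).
  apply: le_trans (_ : 4 * (2 * K * h + 2 * (1 / n.+1%:R)) +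
     8 * (8 * K ^+ 2 * h + 2 / n.+1%:R) <= _).
    apply: lerD; rewrite ler_pM2l//; apply: le_trans t1 _.
    by rewrite lerD2l ler_pM2l.
  rewrite le_eqVlt; apply/orP; left; apply/eqP.
  by rewrite /k0 /h; field; rewrite gt_eqF.
have := two_point_prod_ge (x := fun i => x (t i))
  (M := fun i => I (t i.+1) - I (t i)) cell.
have -> : \prod_(i < n.+1)
     two_point (stopped_inv x t eps i) (I (t i.+1) - I (t i)) (V i) =
   \prod_(i < s) two_point (x (t i))^-1 (I (t i.+1) - I (t i)) (V i).
  rewrite -(big_mkord xpredT (fun i => two_point (stopped_inv x t eps i)
     (I (t i.+1) - I (t i)) (V i))) (@big_cat_nat _ _ _ s)//=.
  rewrite [X in _ * X]big_nat_cond [X in _ * X]big1 ?mulr1; last first.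
    move=> i /andP[/andP[si _] _].
    by rewrite (stopped_inv_after gs si) two_point0.
  rewrite big_mkord; apply: eq_bigr => i _.
  by rewrite (stopped_inv_before before).
set N := \prod_(i < s) _.
have N0 : 0 <= N by apply: prodr_ge0 => i _; exact: two_point_ge0.
rewrite /t grid0 -/t => H.
rewrite ler_pdivrMr//.
apply: le_trans (_ : N * `|x (t s)| <= _); last by rewrite ler_wpM2l.
apply: le_trans H; apply: le_trans (ler_wpM2l (expR_ge0 _) dlx) _.
rewrite ler_wpM2r// ler_expR mulNrn lerN2.
have -> : 8 * K * l + 64 * K ^+ 2 * l + 24 = k0 *+ n.+1.
  by rewrite -[RHS]mulr_natr /k0 divfK// gt_eqF.
exact: ler_wpMn2l.
Qed.

End grid_bound.

(** * Paths reaching zero form a null set *)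

Section local_growth.
Context {R : realType}.

Lemma normr_le_of_quotient_cvg (f s : R -> R) (a l : R) : 1 <= a ->
  (forall x, x != 0 -> `|s x| = `|x| `^ a) ->
  f x / s x @[x --> 0^'] --> l ->
  exists r : R, 0 < r /\
    forall x, x != 0 -> `|x| <= r -> `|f x| <= (`|l| + 1) * `|x|.
Proof.
move=> a1 sa /cvgrPdist_le/(_ 1 ltr01).
rewrite /prop_near1/= /within/= => /nbhs_ballP[e /= e0 H].
exists (Num.min (e / 2) 1); split; first by rewrite lt_min ltr01 divr_gt0.
move=> x x0; rewrite le_min => /andP[xe x1].
have nx0 : 0 < `|x| by rewrite normr_gt0.
have sx0 : 0 < `|s x| by rewrite sa// powR_gt0.
have := H x _ x0; rewrite /ball/= sub0r normrN => /(_ _).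
have xlt : `|x| < e by apply: le_lt_trans xe _; rewrite ltr_pdivrMr// ltr_pMr// ltr1n.
move=> /(_ xlt) d.
have q : `|f x / s x| <= `|l| + 1.
  rewrite -[f x / s x](subrK l) addrC; apply: le_trans (ler_normD _ _) _.
  by rewrite lerD2l distrC.
move: q; rewrite normf_div ler_pdivrMr// => /le_trans; apply.
rewrite ler_wpM2l//.
by rewrite sa// ge1r_powR// nx0.
Qed.

End local_growth.

Section covering.
Context {d : measure_display} {T : measurableType d} {R : realType}.
Context {P : probability T R}.

Lemma negligible_small_cover (A : set T) :
  (forall e : R, 0 < e -> exists B : set T,
     [/\ measurable B, (P B <= e%:E)%E & A `<=` B]) -> P.-negligible A.
Proof.
move=> H.
have H' n : exists B : set T,
    [/\ measurable B, (P B <= (n.+1%:R^-1)%:E)%E & A `<=` B].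
  by apply: H; rewrite invr_gt0.
have [B HB] := choice H'.
have mB n : measurable (B n) by have [] := HB n.
exists (\bigcap_n B n); split.
- exact: bigcapT_measurable.
- apply/eqP; rewrite -measure_le0; apply/lee_addgt0Pr => e e0.
  rewrite add0e.
  have [n ne] : exists n : nat, n.+1%:R^-1 <= e.
    exists (Num.truncn e^-1); rewrite -[leRHS]invrK lef_pV2 ?posrE ?invr_gt0//.
    exact/ltW/truncnS_gt.
  have [_ PB _] := HB n.
  apply: le_trans (_ : (P (B n) <= _)%E); last by rewrite (le_trans PB)// lee_fin.
  by apply: le_measure; rewrite ?inE//; [exact: bigcapT_measurable|exact: bigcap_inf].
- by move=> w Aw n _; have [_ _] := HB n; apply.
Qed.

Lemma measure_eventually_le (E : nat -> set T) (c : R) :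
  (forall n, measurable (E n)) -> (forall n, (P (E n) <= c%:E)%E) ->
  measurable (\bigcup_m \bigcap_(n in [set n | (m <= n)%N]) E n) /\
  (P (\bigcup_m \bigcap_(n in [set n | (m <= n)%N]) E n) <= c%:E)%E.
Proof.
move=> mE PE; pose B m := \bigcap_(n in [set n | (m <= n)%N]) E n.
have mB m : measurable (B m) by apply: bigcap_measurable => //; exists m => /=.
have mU : measurable (\bigcup_m B m) by exact: bigcupT_measurable.
split => //.
have ndB : nondecreasing_seq B.
  move=> m m' mm'; apply/subsetPset => w Bw n /= m'n.
  by apply: Bw => /=; exact: leq_trans m'n.
have cv := nondecreasing_cvg_mu (mu := P) mB mU ndB.
rewrite -(cvg_lim _ cv)//; apply: lime_le; first by apply/cvg_ex; eexists; exact: cv.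
apply: nearW => m; apply: le_trans (PE m).
by apply: le_measure; rewrite ?inE// => w Bw; apply: Bw => /=.
Qed.

End covering.

Section no_hitting.
Context {d : measure_display} {T : measurableType d} {R : realType}.
Context {P : probability T R}.
Context {W : R -> T -> R}.
Hypothesis Pc : measure_is_complete P.
Hypothesis BM : brownian_motion P W.
Variables (b c : R -> R) (x0 r K : R) (X J : R -> T -> R).
Hypothesis c_continuous : continuous c.
Hypothesis r0 : 0 < r.
Hypothesis K0 : 0 <= K.
Hypothesis loc : forall y, y != 0 -> `|y| <= r ->
  `|b y| <= K * `|y| /\ `|c y| <= K * `|y|.
Hypothesis Xad : adapted (augmented_filtration P W) X.
Hypothesis Xcont : as_continuous P X.
Hypothesis JI : ito_integral P W (fun t w => c (X t w)) J.

Local Notation mu := (@lebesgue_measure R).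
Local Notation F := (augmented_filtration P W).
Local Notation known := (@known d T R P W).
Local Notation exp_control := (@exp_control d T R P W).
Local Notation dist2 H t :=
  (fun w => \int[mu]_(s in `[0%R, t]) ((sp_eval H s w - c (X s w)) ^+ 2)%:E)%E.

Lemma path_measurable (w : T) (D : R) :
  {within `[0, +oo[, continuous (fun t : R => X t w)} ->
  measurable_fun `[0, D]%classic (fun t => c (X t w)).
Proof.
move=> cX; apply: (measurableT_comp (continuous_measurable_fun c_continuous)).
apply: subspace_continuous_measurable_fun; first exact: measurable_itv.
apply: continuous_subspaceW cX => u; rewrite /= !in_itv/= andbT.
by case/andP.
Qed.

Lemma coef_path_measurable_ae : {ae P, forall w, forall D : R, 0 <= D ->
  measurable_fun `[0, D]%classic (fun t => c (X t w))}.
Proof. by apply: filterS Xcont => w cX D _; exact: path_measurable. Qed.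

(** The elementary integrals over a degenerate interval are all zero, and they
    tend to [J 0] in probability. *)
Lemma ito_integral_start : {ae P, forall w, J 0 w = 0}.
Proof.
case: JI => Jad _ /(_ 0 (lexx 0))[Hn [_ [mI PI]]].
have JE n w : `|sp_integral W (Hn n) 0 w - J 0 w|%:E = `|J 0 w|%:E.
  by rewrite sp_integral0 sub0r normrN.
suff : P.-negligible (\bigcup_n [set w | (n.+1%:R^-1 <= `|J 0 w|)%R]).
  apply: negligibleS => w /= J0; have J0' : 0 < `|J 0 w|.
    by rewrite normr_gt0; apply/eqP.
  exists (Num.truncn `|J 0 w|^-1) => //=.
  rewrite -[leRHS]invrK lef_pV2 ?posrE ?invr_gt0//.
  exact/ltW/truncnS_gt.
apply: negligible_bigcup => n.
have e0 : (0 : R) < n.+1%:R^-1 by rewrite invr_gt0.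
have := PI _ e0; rewrite (_ : (fun _ => _) = cst (P [set w | (n.+1%:R^-1 <= `|J 0 w|)%R])).
  move=> cv; apply/negligibleP.
    have := mI 0%N; rewrite (funext (JE 0%N)) => mJ.
    rewrite -[X in measurable X]setTI.
    have := emeasurable_fun_c_infty measurableT mJ (n.+1%:R^-1)%:E.
    by under [X in measurable (_ `&` X)]eq_set do rewrite lee_fin.
  have := cvg_unique _ (cvg_cst _ : cst _ @ \oo --> _) cv; apply.
  exact: ereal_hausdorff.
apply/funext => k; congr (P _); apply/seteqP; split => w /=; rewrite JE lee_fin//.
Qed.

(** For a fixed grid only finitely many events are to be avoided, so a late
    enough term of the sequence that approximates the integrand on the whole
    interval serves all the grid points. *)
Lemma simple_approximation (N : nat) (t : nat -> R) (eta e : R) :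
  (forall i, 0 < t i) -> (forall i, (i <= N)%N -> t i <= t N) ->
  0 < eta -> 0 < e ->
  exists (H : simple_process F) (B : set T),
    [/\ measurable B, (P B <= e%:E)%E &
      forall w, ~ B w -> (dist2 H (t N) w <= eta%:E)%E /\
        forall i, (i <= N)%N -> `|sp_integral W H (t i) w - J (t i) w| <= eta].
Proof.
move=> t0 tN eta0 e0; case: JI => Jad _ JH.
have [H [DH IH]] := JH _ (ltW (t0 N)).
(* one event for the integrand and [N.+1] for the grid points *)
pose e' := e / N.+2%:R.
have e'0 : 0 < e' by rewrite divr_gt0.
pose A i k := [set w | eta <= `|sp_integral W (H k) (t i) w - J (t i) w|].
pose B m k := [set w | (eta%:E <= dist2 (H k) (t N) w)%E] `|`
  \big[setU/set0]_(i < m) A i k.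
have nearB m : (m <= N.+1)%N -> \forall k \near \oo,
    measurable (B m k) /\ (P (B m k) <= (e' *+ m.+1)%:E)%E.
  elim: m => [_|m IHm mN].
    have [mD PD] := DH.
    near=> k; rewrite /B big_ord0 setU0; split.
      rewrite -[X in measurable X]setTI; exact: emeasurable_fun_c_infty.
    by apply: ltW; near: k; exact: cvge0_near_lt (PD _ eta0) e'0.
  have [H' [DH' IH']] := JH _ (ltW (t0 m)).
  have tm : t m <= t N by exact: tN.
  have nearA := sp_integral_consistent Pc BM coef_path_measurable_ae Jad
    (t0 m) tm DH DH' IH' eta0 e'0.
  near=> k.
  have Bm : measurable (B m k) /\ (P (B m k) <= (e' *+ m.+1)%:E)%E.
    by near: k; exact: (IHm (ltnW mN)).
  have Am : measurable (A m k) /\ (P (A m k) <= e'%:E)%E by near: k; exact: nearA.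
  rewrite /B big_ord_recr/= setUA mulrSr.
  exact: probability_setU_le.
have [k _ /(_ k (leqnn k))[mB PB]] := nearB N.+1 (leqnn _).
exists (H k), (B N.+1 k); split => //.
  by apply: le_trans PB _; rewrite -mulr_natr /e' divfK.
move=> w nB; split.
  rewrite leNgt; apply/negP => /ltW ?; apply: nB; by left.
move=> i iN; rewrite leNgt; apply/negP => /ltW ?; apply: nB; right.
by rewrite -(bigcup_mkord _ (fun i => A i k)); exists i.
Unshelve. all: by end_near. Qed.

Lemma known_stopped_inv (t : nat -> R) (eps : R) (i : nat) :
  (forall k, 0 <= t k) -> (forall k, (k <= i)%N -> t k <= t i) ->
  known (t i) (fun w => stopped_inv (X ^~ w) t eps i).
Proof.
move=> t0 ti.
have kX k : (k <= i)%N -> known (t i) (X (t k)).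
  by move=> ki; apply: known_mono (ti k ki) _; apply: measurable_wrt_known; exact: Xad.
apply: measurable_funM.
  by apply: measurableT_comp; [exact: measurable_inv|exact: kX].
apply: measurable_prod => k _.
rewrite (_ : (fun w => _) = fun w => if (eps < `|X (t k) w|)%R then 1 else 0); last first.
  by apply/funext => w; case: ifP.
apply: measurable_fun_ifT => //.
apply: measurable_fun_ltr => //.
apply: measurableT_comp => //; apply: kX.
by rewrite -ltnS.
Qed.

(** The starting time [q], the horizon [l] and the lower bound [dl] are fixed
    so that one estimate holds for all the paths of the event; countably many
    choices of them exhaust the paths that vanish somewhere. *)
Definition hits_zero (q l dl : R) : set T := [set w |
  [/\ {within `[0, +oo[, continuous (fun t : R => X t w)},
      forall t, 0 <= t -> mu.-integrable `[0, t] (fun s => (b (X s w))%:E),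
      forall t, 0 <= t ->
        X t w = x0 + Rintegral mu `[0, t] (fun s => b (X s w)) + J t w &
      exists tau, [/\ q < tau <= q + l, X tau w = 0, dl <= `|X q w| &
        forall u, q <= u <= tau -> `|X u w| <= r] ] ].

(** On a grid fine enough for the path, either the approximating simple process
    is not close to the solution or the product of the [two_point] factors
    is at least [L]; both events have probability at most [e / 2] on every grid. How
    fine the grid must be depends on the path, hence the limit inferior of the
    events. *)
Lemma negligible_hits_zero (q l dl : R) : 0 < q -> 0 < l -> 0 < dl ->
  P.-negligible (hits_zero q l dl).
Proof.
move=> q0 l0 dl0; apply: negligible_small_cover => e e0.
pose C := 8 * K * l + 64 * K ^+ 2 * l + 24.
(* eps makes the Markov bound [L^-1] at most [e / 2] *)
pose eps := Num.min 1 (e / 2 * (expR (- C) * dl)).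
have CD0 : 0 < expR (- C) * dl by rewrite mulr_gt0// expR_gt0.
have e20 : 0 < e / 2 by rewrite divr_gt0.
have eps0 : 0 < eps by rewrite lt_min ltr01 mulr_gt0.
have eps1 : eps <= 1 by rewrite ge_min lexx.
pose L := expR (- C) * dl / eps.
have L0 : 0 < L by rewrite divr_gt0.
have Le : L^-1 <= e / 2.
  by rewrite /L invf_div ler_pdivrMr// ge_min lexx orbT.
have gt0' n i : 0 < grid q l n i.
  by rewrite /grid ltr_wpDr// mulr_ge0// divr_ge0// ltW.
have gle n i k : (i <= k)%N -> grid q l n i <= grid q l n k.
  by apply: grid_le; exact: ltW.
have main n : exists E : set T, [/\ measurable E, (P E <= e%:E)%E &
    forall w, hits_zero q l dl w ->
      (forall u v, q <= u <= q + l -> q <= v <= q + l -> `|u - v| <= l / n.+1%:R ->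
        `|X u w - X v w| <= eps / 4) -> E w].
  pose t := grid q l n; pose eta := eps ^+ 2 / n.+1%:R.
  have eta0 : 0 < eta by rewrite divr_gt0// exprn_gt0.
  have [H [B [mB PB HB]]] := simple_approximation (gt0' n) (gle n ^~ n.+1) eta0 e20.
  have ctl i : exists V : T -> R, exp_control (t i) (t i.+1)
      (fun w => sp_integral W H (t i.+1) w - sp_integral W H (t i) w) V /\
      forall w, measurable_fun `]t i, t i.+1]%classic (sp_eval H ^~ w) /\
      (\int[mu]_(u in `](t i), (t i.+1)]) (sp_eval H u w ^+ 2)%:E = (V w)%:E)%E.
    apply: (step_integral_control Pc BM (@step_integral_simple d T R P W H)).
      exact/ltW/gt0'.
    by rewrite /t gridS ltrDl divr_gt0.
  have [V HV] := choice ctl.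
  pose a i w := stopped_inv (X ^~ w) t eps i.
  pose M i w := sp_integral W H (t i.+1) w - sp_integral W H (t i) w.
  have ka i : known (t i) (a i).
    by apply: known_stopped_inv => k; [exact/ltW/gt0'|exact: gle].
  have [kN IN] := two_point_prod_le1 Pc BM (fun i => gle n _ _ (leqnSn i))
    (fun i => (HV i).1) ka n.+1.
  have N0 w : 0 <= two_point_prod a M V n.+1 w.
    by apply: prodr_ge0 => i _; exact: two_point_ge0.
  have [mA PA] := markov_le (known_measurable Pc BM kN) N0 IN L0.
  exists ([set w | L <= two_point_prod a M V n.+1 w] `|` B).
  have [mU PU] : measurable ([set w | L <= two_point_prod a M V n.+1 w] `|` B) /\
      (P ([set w | (L <= two_point_prod a M V n.+1 w)%R] `|` B) <= (e / 2 + e / 2)%:E)%E.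
    by apply: probability_setU_le; split => //; apply: le_trans PA _; rewrite lee_fin.
  split => //; first by rewrite (splitr e).
  move=> w [cX intb eqX [tau [qtau Xtau dlX small]]] osc.
  have [Bw|nBw] := pselect (B w); [by right|left => /=].
  have [D2 Iclose] := HB w nBw.
  have VE i := ((HV i).2 w).2.
  apply: (two_point_prod_grid_ge (b := b) (c := c) (x := X ^~ w) (j := J ^~ w)
    (I := fun u => sp_integral W H u w) (V := fun i => V i w) (x0 := x0) (r := r)
    (tau := tau)) => //.
  - exact: ltW.
  - by move=> i; rewrite -lee_fin -VE integral_ge0// => u _; rewrite lee_fin sqr_ge0.
  - move=> i C' iN cC.
    apply: (step_quadratic_variation_le (h := sp_eval H ^~ w)
      (Y := fun u => c (X u w)) (t0 := grid q l n n.+1) (s := t i)) => //.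
    + exact/ltW/gt0'.
    + exact: gle.
    + exact: gle.
    + exact: measurable_sp_eval.
    + exact: path_measurable.
have [E HE] := choice main.
have mE n : measurable (E n) by have [] := HE n.
have PE n : (P (E n) <= e%:E)%E by have [] := HE n.
have [mU PU] := measure_eventually_le mE PE.
exists (\bigcup_m \bigcap_(n in [set n | (m <= n)%N]) E n); split => //.
move=> w hw; have [cX _ _ _] := hw.
have eps40 : 0 < eps / 4 by rewrite divr_gt0.
have [de de0 uc] := path_uniformly_continuous (q + l) cX (ltW q0) eps40.
exists (Num.truncn (l / de)) => // n /= mn.
have [_ _] := HE n; apply => // u v uq vq uv.
apply: uc => //; apply: le_lt_trans uv _.
rewrite ltr_pdivrMr// mulrC -ltr_pdivrMr//.
by apply: lt_le_trans (truncnS_gt _) _; rewrite ler_nat.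
Qed.

Hypothesis x0_neq0 : x0 != 0.
Hypothesis Xint : {ae P, forall w, forall t : R, 0 <= t ->
  mu.-integrable `[0, t] (fun s => (b (X s w))%:E)}.
Hypothesis Xeq : {ae P, forall w, forall t : R, 0 <= t ->
  X t w = x0 + Rintegral mu `[0, t] (fun s => b (X s w)) + J t w}.

(** A path that vanishes somewhere has a first zero [tau]; at a rational time
    [q] shortly before [tau] it is nonzero, and it stays small up to [tau]. *)
Lemma negligible_zero : P.-negligible [set w | exists2 t, 0 <= t & X t w = 0].
Proof.
pose good w := [/\ {within `[0, +oo[, continuous (fun t : R => X t w)},
  forall t, 0 <= t -> mu.-integrable `[0, t] (fun s => (b (X s w))%:E),
  forall t, 0 <= t -> X t w = x0 + Rintegral mu `[0, t] (fun s => b (X s w)) + J t w &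
  J 0 w = 0].
have aegood : {ae P, forall w, good w}.
  apply: filterS (filterI (filterI Xcont Xint) (filterI Xeq ito_integral_start)).
  by move=> w [[? ?] [? ?]].
(* the events with rational [q], enumerated by natural numbers *)
pose bad (n : nat) : set T := match unpickle n with
  | Some (q, l, m) =>
      if (0 < ratr q :> R) then hits_zero (ratr q : R) l.+1%:R m.+1%:R^-1 else set0
  | None => set0 end.
have nbad n : P.-negligible (bad n).
  rewrite /bad; case: (unpickle n) => [[[q l] m]|]; last exact: negligible_set0.
  case: ifP => [q0|_]; last exact: negligible_set0.
  by apply: negligible_hits_zero => //; rewrite invr_gt0.
apply: negligibleS (negligibleU aegood (negligible_bigcup nbad)) => w [t t0 Xt].
have [gw|ngw] := pselect (good w); [right|by left].
have [cX intb eqX J0] := gw.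
have X0 : X 0 w = x0.
  by rewrite eqX// J0 addr0 set_itv1 Rintegral_set1 addr0.
have X0n : X 0 w != 0 by rewrite X0.
have [tau [tau0 Xtau before]] := path_first_zero cX X0n t0 Xt.
have [de de0 uc] := path_continuousP cX (ltW tau0) r0.
have lt : Num.max 0 (tau - de) < tau by rewrite gt_max tau0 ltrBlDr ltrDl.
have [q] := rat_in_itvoo lt.
rewrite in_itv/= gt_max => /andP[/andP[q0 qde] qtau].
have Xq : X (ratr q) w != 0 by apply: before; rewrite ltW.
have [l ql] : exists l : nat, tau - ratr q <= l.+1%:R.
  by exists (Num.truncn (tau - ratr q)); exact/ltW/truncnS_gt.
have [m mX] : exists m : nat, m.+1%:R^-1 <= `|X (ratr q) w|.
  exists (Num.truncn `|X (ratr q) w|^-1).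
  rewrite -[leRHS]invrK lef_pV2 ?posrE ?invr_gt0 ?normr_gt0//.
  exact/ltW/truncnS_gt.
suff hz : hits_zero (ratr q) l.+1%:R m.+1%:R^-1 w.
  by exists (pickle (q, l, m)); [|rewrite /bad pickleK q0].
split => //; exists tau; split => //; first by rewrite qtau -lerBlDl.
move=> u /andP[u1 u2].
have udist : `|tau - u| < de.
  by rewrite ger0_norm ?subr_ge0// ltrBlDl -ltrBlDr; exact: lt_le_trans u1.
have := uc u (le_trans (ltW q0) u1) udist.
by rewrite Xtau sub0r normrN.
Qed.

End no_hitting.

(** * The theorem *)

Unset Implicit Arguments.

Theorem theorem2 (R : realType) (d : measure_display) (T : measurableType d)
  (P : probability T R) (P_complete : measure_is_complete P)
  (W : R -> T -> R) (W_brownian : brownian_motion P W)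
  (g gamma : R -> R)
  (g_lip : locally_lipschitz g) (gamma_yw : yamada_watanabe gamma)
  (lambda mu kappa A nu beta sigma alpha : R)
  (kappa_gt0 : 0 < kappa)
  (H1 : g x / signed_powR x (1 + kappa) @[x --> 0^'] --> mu)
  (A_gt0 : 0 < A) (beta_gt0 : 0 < beta)
  (H2 : forall x : R, A <= `|x| -> x * g x <= - nu * `|x| `^ (2 + beta))
  (sigma_ge0 : 0 <= sigma) (alpha_gt0 : 0 < alpha)
  (H3 : `|gamma x| / `|x| `^ alpha @[x --> 0^'] --> sigma)
  (H4pos : 0 < nu -> exists2 D : R, 0 < D &
     exists M : R, forall x : R, M <= `|x| ->
       gamma x ^+ 2 <= D * `|x| `^ (1 + beta))
  (H4neg : nu < 0 -> exists D delta : R, [/\ 0 < D, 2 + beta < delta &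
     exists M : R, forall x : R, M <= `|x| ->
       D * `|x| `^ delta <= gamma x ^+ 2])
  (H5 : forall x : R, gamma x = 0 <-> x = 0)
  (alpha_ge1 : 1 <= alpha)
  (x0 : R) (x0_neq0 : x0 != 0)
  (X : R -> T -> R)
  (X_sol : sde_solution P W (fun x => lambda * x + g x) gamma x0 X) :
  measurable [set w | forall t : R, 0 <= t -> X t w != 0] /\
  P [set w | forall t : R, 0 <= t -> X t w != 0] = 1%E.
Proof.
have [r1 [r10 gK]] : exists r : R, 0 < r /\
    forall x, x != 0 -> `|x| <= r -> `|g x| <= (`|mu| + 1) * `|x|.
  apply: (normr_le_of_quotient_cvg (a := 1 + kappa) _ _ H1); first by rewrite lerDl ltW.
  move=> x x_neq0; rewrite /signed_powR normrM normr_sg x_neq0 mul1r.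
  by rewrite ger0_norm// powR_ge0.
have [r2 [r20 gammaK]] : exists r : R, 0 < r /\
    forall x, x != 0 -> `|x| <= r -> `|gamma x| <= (`|sigma| + 1) * `|x|.
  have [r [r0 H]] := normr_le_of_quotient_cvg (f := fun x => `|gamma x|) alpha_ge1
    (fun x _ => ger0_norm (powR_ge0 `|x| alpha)) H3.
  by exists r; split => // x x_neq0 /(H x x_neq0); rewrite normr_id.
pose K := `|lambda| + (`|mu| + 1) + (`|sigma| + 1).
have K0 : 0 <= K by rewrite !addr_ge0.
have r0 : 0 < Num.min r1 r2 by rewrite lt_min r10.
have loc y : y != 0 -> `|y| <= Num.min r1 r2 ->
    `|lambda * y + g y| <= K * `|y| /\ `|gamma y| <= K * `|y|.
  move=> y0; rewrite le_min => /andP[yr1 yr2]; split.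
    apply: le_trans (ler_normD _ _) _; rewrite normrM.
    apply: le_trans (_ : (`|lambda| + (`|mu| + 1)) * `|y| <= _).
      by rewrite mulrDl lerD2l gK.
    by rewrite ler_wpM2r// lerDl addr_ge0.
  apply: le_trans (gammaK y y0 yr2) _.
  by rewrite ler_wpM2r// lerDr addr_ge0// addr_ge0.
case: X_sol => Xad Xcont Xint [J JI Xeq].
have Xb : {ae P, forall w, forall t : R, 0 <= t -> lebesgue_measure.-integrable
    `[0, t] (fun s => (lambda * X s w + g (X s w))%:E)}.
  by apply: filterS Xint => w H t /H[].
have nZ := negligible_zero P_complete W_brownian
  (yamada_watanabe_continuous gamma_yw) r0 K0 loc Xad Xcont JI x0_neq0 Xb Xeq.
set good := [set w | _].
have goodE : good = ~` [set w | exists2 t, 0 <= t & X t w = 0].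
  apply/seteqP; split => w /=.
    by move=> gw [t t0 Xt]; have := gw t t0; rewrite Xt eqxx.
  by move=> nZw t t0; apply/eqP => Xt; apply: nZw; exists t.
have mZ := P_complete _ nZ.
split; first by rewrite goodE; exact: measurableC.
rewrite goodE probability_setC// (measure_negligible mZ nZ).
exact: sube0.
Qed.
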